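(* Let $G$ be a non-discrete LCA group with dual $\Gamma$ and $V$ an open neighbourhood of $0\in\Gamma$ with compact closure $\bar V$. (i) Let $0\ne\mu\in M_0(G)$. For every $\varepsilon>0$ there exists a compact set $\Omega_\varepsilon\subseteq\Gamma$ with dense nonempty interior such that $\sup_{\gamma\in\Gamma\setminus\Omega_\varepsilon}\|\hat\mu\|^{\bar V,\gamma}\le\varepsilon$. (ii) $M_0(G)=\mathcal L^1_{\bar V}(G)\cap M(G)$.
   Context: $G$ non-discrete LCA with dual $\Gamma$, $(x,\gamma)=\gamma(x)$, Haar measures normalized for Fourier inversion; $M(G)$ the measure algebra with total variation norm, $L^1(G)\subset M(G)$, $\hat\mu(\gamma)=\int_G(-x,\gamma)d\mu(x)$. $M_0(G)$ (Rajchman measures) is the set of $\mu\in M(G)$ with $\hat\mu\in C_0(\Gamma)$. For $E\subseteq\Gamma$, $\mathrm{span}(E)$ is the span of the characters in $E$ as functions on $G$, each $p$ uniquely $\sum\hat p(\gamma)\gamma$, $\|p\|_\infty=\sup_G|p|$. For $\phi\in C_b(\Gamma)$: $\|\phi\|^{\bar V,\gamma}=\sup\{|\sum_{\gamma'\in\bar V+\gamma}\hat p(\gamma')\phi(\gamma')|:p\in\mathrm{span}(\bar V+\gamma),\|p\|_\infty\le1\}$, $\|\phi\|^{\bar V}=\sup_\gamma\|\phi\|^{\bar V,\gamma}$. For $\mu\in M(G)$, $\|\mu\|_{\bar V}=\|\hat\mu\|^{\bar V}$, an algebra norm dominated by $\|\mu\|$. $\mathcal M_{\bar V}(G)$ is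 the completion of $(M(G),\|\cdot\|_{\bar V})$ (so $M(G)\subseteq\mathcal M_{\bar V}(G)$) and $\mathcal L^1_{\bar V}(G)$ is the closure of $L^1(G)$ in $\mathcal M_{\bar V}(G)$. *)

(* Defs.v *)
From HB Require Import structures.
From mathcomp Require Import all_boot all_order all_algebra.
From mathcomp Require Import all_classical all_reals all_analysis.
From mathcomp Require Import complex.
Set Implicit Arguments. Unset Strict Implicit. Unset Printing Implicit Defensive.
Import Order.TTheory GRing.Theory Num.Theory.
Import numFieldNormedType.Exports.
Local Open Scope classical_set_scope.
Local Open Scope ring_scope.

Definition cabs (R : realType) (z : R[i]) : R := complex.Re `|z|.

(* G with its Borel sigma-algebra (generated by the open sets of G).   *)
(* BorelT G is a copy of (the carrier of) G carrying this measurable   *)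
(* structure (the point 0 is only needed by the library's structures). *)
Definition BorelT (G : topologicalZmodType) : Type := G.
HB.instance Definition _ (G : topologicalZmodType) := Choice.on (BorelT G).
HB.instance Definition _ (G : topologicalZmodType) :=
  isPointed.Build (BorelT G) (0%R : G).
Definition borel_display (G : topologicalZmodType) : measure_display.
Proof. exact: default_measure_display. Qed.
HB.instance Definition _ (G : topologicalZmodType) :=
  @isMeasurable.Build (borel_display G) (BorelT G) <<s @open G >>
  (@sigma_algebra0 _ setT _) (@sigma_algebraC _ _)
  (@sigma_algebra_bigcup _ setT _).
Notation Borel G := (BorelT G).

Definition nondiscrete (G : topologicalZmodType) : Prop :=
  ~ (forall x : G, open [set x]).

(* An element of Gamma is a continuous homomorphism G -> T (unit     *)
(* circle in C = R[i]); Gamma is written additively in the paper: the *)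
(* sum of characters is their pointwise product, 0 is the constant 1. *)

Definition character (R : realType) (G : topologicalZmodType)
    (g : G -> R[i]) : Prop :=
  continuous (fun x => complex.Re (g x)) /\
  continuous (fun x => complex.Im (g x)) /\
  (forall x y : G, g (x + y) = g x * g y) /\
  (forall x : G, cabs (g x) = 1).

Definition dual (R : realType) (G : topologicalZmodType) : set (G -> R[i]) :=
  [set g | character g].

Definition dual_zero (R : realType) (G : topologicalZmodType) : G -> R[i] :=
  fun _ => 1.

Definition dual_add (R : realType) (G : topologicalZmodType)
    (g1 g2 : G -> R[i]) : G -> R[i] := fun x => g1 x * g2 x.

(* Topology of Gamma: the topology of uniform convergence on compact  *)
(* subsets of G (compact-open topology), given by its basic           *)
(* neighbourhoods.                                                     *)
Definition dual_basic_nbhd (R : realType) (G : topologicalZmodType)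
    (g : G -> R[i]) (K : set G) (e : R) : set (G -> R[i]) :=
  [set g' | character g' /\ forall x, K x -> cabs (g' x - g x) < e].

Definition dual_open (R : realType) (G : topologicalZmodType)
    (U : set (G -> R[i])) : Prop :=
  U `<=` @dual R G /\
  forall g, U g -> exists (K : set G) (e : R),
      [/\ compact K, 0 < e & dual_basic_nbhd g K e `<=` U].

Definition dual_compact (R : realType) (G : topologicalZmodType)
    (A : set (G -> R[i])) : Prop :=
  A `<=` @dual R G /\
  forall (I : Type) (F : I -> set (G -> R[i])),
    (forall i, dual_open (F i)) -> A `<=` \bigcup_i F i ->
    exists D : set I, finite_set D /\ A `<=` \bigcup_(i in D) F i.

Definition dual_interior (R : realType) (G : topologicalZmodType)
    (A : set (G -> R[i])) : set (G -> R[i]) :=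
  [set g | exists U, [/\ dual_open U, U g & U `<=` A]].

Definition dual_closure (R : realType) (G : topologicalZmodType)
    (A : set (G -> R[i])) : set (G -> R[i]) :=
  [set g | character g /\
           forall U, dual_open U -> U g -> (U `&` A) !=set0].

Definition dual_shift (R : realType) (G : topologicalZmodType)
    (A : set (G -> R[i])) (g : G -> R[i]) : set (G -> R[i]) :=
  [set g' | exists v, A v /\ g' = dual_add v g].

Definition dual_continuous (R : realType) (G : topologicalZmodType)
    (phi : (G -> R[i]) -> R[i]) : Prop :=
  forall g, character g -> forall e : R, 0 < e ->
    exists U, [/\ dual_open U, U g &
                  forall g', U g' -> cabs (phi g' - phi g) < e].

Definition C0_dual (R : realType) (G : topologicalZmodType)
    (phi : (G -> R[i]) -> R[i]) : Prop :=
  dual_continuous phi /\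
  forall e : R, 0 < e -> exists K, dual_compact K /\
    forall g, character g -> ~ K g -> cabs (phi g) < e.

Definition cint (R : realType) (G : topologicalZmodType)
    (m : {measure set (Borel G) -> \bar R}) (f : G -> R[i]) : R[i] :=
  Complex (Rintegral m setT (fun x : Borel G => complex.Re (f x)))
          (Rintegral m setT (fun x : Borel G => complex.Im (f x))).

Definition regular_measure (R : realType) (G : topologicalZmodType)
    (m : {measure set (Borel G) -> \bar R}) : Prop :=
  (forall E : set (Borel G), measurable E ->
     m E = ereal_inf [set m U | U in [set U : set G | open U /\ E `<=` U]]) /\
  (forall E : set (Borel G), measurable E ->
     m E = ereal_sup [set m K | K in [set K : set G | compact K /\ K `<=` E]]).

(* A complex Borel measure mu = (m1 - m2) + i (m3 - m4). *)
Record cmeasure (R : realType) (G : topologicalZmodType) := CMeasure {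
  cm1 : {measure set (Borel G) -> \bar R};
  cm2 : {measure set (Borel G) -> \bar R};
  cm3 : {measure set (Borel G) -> \bar R};
  cm4 : {measure set (Borel G) -> \bar R} }.

(* mu belongs to M(G): complex regular Borel measure (every complex   *)
(* regular Borel measure has such a decomposition, e.g. Jordan).      *)
Definition in_M (R : realType) (G : topologicalZmodType)
    (mu : cmeasure R G) : Prop :=
  [/\ (cm1 mu setT < +oo)%E, (cm2 mu setT < +oo)%E,
      (cm3 mu setT < +oo)%E & (cm4 mu setT < +oo)%E] /\
  [/\ regular_measure (cm1 mu), regular_measure (cm2 mu),
      regular_measure (cm3 mu) & regular_measure (cm4 mu)].

Definition cm_val (R : realType) (G : topologicalZmodType)
    (mu : cmeasure R G) (E : set (Borel G)) : R[i] :=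
  Complex (fine (cm1 mu E) - fine (cm2 mu E))
          (fine (cm3 mu E) - fine (cm4 mu E)).

Definition cm_nonzero (R : realType) (G : topologicalZmodType)
    (mu : cmeasure R G) : Prop :=
  exists E : set (Borel G), measurable E /\ cm_val mu E != 0.

Definition cm_int (R : realType) (G : topologicalZmodType)
    (mu : cmeasure R G) (f : G -> R[i]) : R[i] :=
  (cint (cm1 mu) f - cint (cm2 mu) f) +
  'i * (cint (cm3 mu) f - cint (cm4 mu) f).

Definition hatM (R : realType) (G : topologicalZmodType)
    (mu : cmeasure R G) : (G -> R[i]) -> R[i] :=
  fun g => cm_int mu (fun x => g (- x)).

Definition haar (R : realType) (G : topologicalZmodType)
    (m : {measure set (Borel G) -> \bar R}) : Prop :=
  [/\ (forall K : set G, compact K -> (m K < +oo)%E),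
      (forall E : set (Borel G), measurable E ->
         m E = ereal_inf [set m U | U in [set U : set G | open U /\ E `<=` U]]),
      (forall U : set G, open U ->
         m U = ereal_sup [set m K | K in [set K : set G | compact K /\ K `<=` U]]),
      (forall (x : G) (E : set (Borel G)), measurable E ->
         m [set x + y | y in E] = m E) &
      (forall U : set G, open U -> U !=set0 -> (0 < m U)%E)].

Definition L1 (R : realType) (G : topologicalZmodType)
    (m : {measure set (Borel G) -> \bar R}) (f : G -> R[i]) : Prop :=
  m.-integrable setT (fun x : Borel G => (complex.Re (f x))%:E) /\
  m.-integrable setT (fun x : Borel G => (complex.Im (f x))%:E).

Definition hatL (R : realType) (G : topologicalZmodType)
    (m : {measure set (Borel G) -> \bar R}) (f : G -> R[i]) :
    (G -> R[i]) -> R[i] :=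
  fun g => cint m (fun x => f x * g (- x)).

(* An element p of span(S) is sum_{i<n} c_i gamma_i with distinct      *)
(* gamma_i in S; then hat p (gamma_i) = c_i.                           *)

Definition span_norm (R : realType) (G : topologicalZmodType)
    (S : set (G -> R[i])) (phi : (G -> R[i]) -> R[i]) : \bar R :=
  ereal_sup [set r | exists (n : nat) (c : 'I_n -> R[i])
                              (g : 'I_n -> (G -> R[i])),
     [/\ injective g, (forall i, S (g i)),
         (forall x : G, cabs (\sum_(i < n) c i * g i x) <= 1) &
         r = (cabs (\sum_(i < n) c i * phi (g i)))%:E]].

Definition normVg (R : realType) (G : topologicalZmodType)
    (V : set (G -> R[i])) (phi : (G -> R[i]) -> R[i]) (g : G -> R[i]) :
    \bar R :=
  span_norm (dual_shift (dual_closure V) g) phi.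

Definition normV (R : realType) (G : topologicalZmodType)
    (V : set (G -> R[i])) (phi : (G -> R[i]) -> R[i]) : \bar R :=
  ereal_sup [set normVg V phi g | g in @dual R G].

Definition M0 (R : realType) (G : topologicalZmodType)
    (mu : cmeasure R G) : Prop :=
  in_M mu /\ C0_dual (hatM mu).

(* Main.v *)
(* Trigonometric polynomials with spectrum in a compact set of characters and sup norm at
   most 1 are uniformly equicontinuous. This is a Bernstein inequality, obtained from the
   half-angle formula: 1 - cos(t) = 1 - sqrt (1 - sin^2 t) is a power series in sin^2 t
   with nonnegative coefficients, so each halving of the translation halves the
   multiplier norm of 1 - cos, and small second differences of a bounded function force
   small first differences.

   On a compact subset of G carrying almost all of mu, the unit ball of span(V) is
   therefore totally bounded. The functional q |-> \int q(-x) gamma(-x) dmu(x) tends to 0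
   as gamma leaves compact sets for each of the finitely many members of a net, because
   mu is a Rajchman measure, hence uniformly on the ball; this is (i).

   In (ii), limits of transforms of integrable functions vanish at infinity because the
   V-norm dominates the sup norm and by the Riemann-Lebesgue lemma: where the transform
   of 1_K is at least e in modulus the characters are equicontinuous, and such sets are
   compact by Ascoli's theorem. Conversely mu is approximated by nu * 1_O / m(O), with O a
   small neighbourhood of 0 and nu a discretisation of mu: low frequencies are handled by
   equicontinuity, high ones by (i) applied to mu and to 1_O / m(O). *)
Require Import Defs.
From HB Require Import structures.
From mathcomp Require Import all_boot all_order all_algebra.
From mathcomp Require Import all_classical all_reals all_analysis.
From mathcomp Require Import complex finmap measurable_realfun.
From mathcomp Require Import ring lra.
Set Implicit Arguments. Unset Strict Implicit. Unset Printing Implicit Defensive.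
Import Order.TTheory GRing.Theory Num.Theory.
Local Open Scope classical_set_scope.
Local Open Scope ring_scope.
Import numFieldNormedType.Exports.

(** * Bernstein inequality for polynomials with spectrum near the origin *)

(** The obstacle is uniformity over the unit ball. The sup norm of a polynomial does not control the
    sum of the moduli of its coefficients, so termwise estimates are useless, and a general group
    offers no derivative for the classical Bernstein inequality. Multiplier norms that are bounded
    through translations alone do not see the coefficients.

    A polynomial with spectrum in V + gamma is gamma times one with spectrum in V and has the same
    modulus. Hence (i) needs equicontinuity for the fixed set V only, whatever gamma is.

    Measures enter through properties of the functional that pairs a polynomial with a transform.
    [tight_functional] and [discretizable] pass to combinations phi + b psi, so they are proved for
    the four positive components of mu. Vanishing at infinity cannot be split in this way: it holds
    for mu as a whole, and its components need not be Rajchman measures. This is why the later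
    estimates speak of functionals on polynomials instead of positive measures. *)

Section Cabs.
Context {R : realType}.
Implicit Types z w : R[i].

Lemma cabsE z : cabs z = Normc.normc z.
Proof. by rewrite /cabs normc_def; case: z. Qed.

Lemma cabs_ge0 z : 0 <= cabs z.
Proof. by rewrite cabsE; case: z => a b; exact: sqrtr_ge0. Qed.

Lemma cabsD z w : cabs (z + w) <= cabs z + cabs w.
Proof. by rewrite !cabsE; exact: le_normcD. Qed.

Lemma cabsN z : cabs (- z) = cabs z.
Proof. by rewrite !cabsE; exact: normcN. Qed.

Lemma cabsB z w : cabs (z - w) <= cabs z + cabs w.
Proof. by rewrite -(cabsN w); exact: cabsD. Qed.

Lemma cabsBC z w : cabs (z - w) = cabs (w - z).
Proof. by rewrite -cabsN opprB. Qed.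

Lemma cabs_dist z w t : cabs (z - t) <= cabs (z - w) + cabs (w - t).
Proof. by apply: le_trans (cabsD _ _); rewrite addrA subrK. Qed.

Lemma cabsM z w : cabs (z * w) = cabs z * cabs w.
Proof. by rewrite !cabsE; exact: Normc.normcM. Qed.

Lemma cabs0 : cabs (0 : R[i]) = 0.
Proof. by rewrite cabsE; exact: Normc.normc0. Qed.

Lemma cabs1 : cabs (1 : R[i]) = 1.
Proof. by rewrite cabsE; exact: Normc.normc1. Qed.

Lemma cabs_real (a : R) : cabs (Complex a 0) = `|a|.
Proof. by rewrite cabsE /Normc.normc expr0n /= addr0 sqrtr_sqr. Qed.


Lemma cabs_natr n : cabs (n%:R : R[i]) = n%:R.
Proof.
by rewrite -(rmorph_nat (@real_complex_def R (Phant R)) n) cabs_real ger0_norm.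
Qed.

Lemma cabs_natrV n : cabs (n%:R^-1 : R[i]) = n%:R^-1.
Proof.
by rewrite -(rmorph_nat (@real_complex_def R (Phant R)) n) -fmorphV cabs_real ger0_norm// invr_ge0.
Qed.

Lemma cabs_sqr z : cabs z ^+ 2 = complex.Re z ^+ 2 + complex.Im z ^+ 2.
Proof. by rewrite cabsE; case: z => a b /=; rewrite sqr_sqrtr// addr_ge0 ?sqr_ge0. Qed.

Lemma ler_Re_cabs z : `|complex.Re z| <= cabs z.
Proof.
rewrite -(ler_pXn2r (n := 2)) ?nnegrE ?normr_ge0 ?cabs_ge0//.
by rewrite cabs_sqr real_normK ?num_real// lerDl sqr_ge0.
Qed.

Lemma ler_Im_cabs z : `|complex.Im z| <= cabs z.
Proof.
rewrite -(ler_pXn2r (n := 2)) ?nnegrE ?normr_ge0 ?cabs_ge0//.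
by rewrite cabs_sqr real_normK ?num_real// lerDr sqr_ge0.
Qed.

Lemma ler_cabs_ReIm z : cabs z <= `|complex.Re z| + `|complex.Im z|.
Proof.
rewrite -(ler_pXn2r (n := 2)) ?nnegrE ?addr_ge0 ?normr_ge0 ?cabs_ge0//.
rewrite cabs_sqr -(real_normK (num_real (complex.Re z))).
rewrite -(real_normK (num_real (complex.Im z))).
have := normr_ge0 (complex.Re z); have := normr_ge0 (complex.Im z); nra.
Qed.

Lemma cabs_sum (I : finType) (F : I -> R[i]) :
  cabs (\sum_i F i) <= \sum_i cabs (F i).
Proof.
elim/big_ind2 : _ => //[|x1 x2 y1 y2 h1 h2]; first by rewrite cabs0.
by rewrite (le_trans (cabsD _ _))// lerD.
Qed.

Lemma ReD z w : complex.Re (z + w) = complex.Re z + complex.Re w.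
Proof. by case: z; case: w. Qed.
Lemma ImD z w : complex.Im (z + w) = complex.Im z + complex.Im w.
Proof. by case: z; case: w. Qed.
Lemma ReM z w : complex.Re (z * w) =
  complex.Re z * complex.Re w - complex.Im z * complex.Im w.
Proof. by case: z; case: w. Qed.
Lemma ImM z w : complex.Im (z * w) =
  complex.Re z * complex.Im w + complex.Im z * complex.Re w.
Proof. by case: z => a b; case: w => c d /=. Qed.
Lemma ReN z : complex.Re (- z) = - complex.Re z.
Proof. by case: z. Qed.
Lemma ImN z : complex.Im (- z) = - complex.Im z.
Proof. by case: z. Qed.

End Cabs.

(* N times the first difference telescopes to F N - F 0 up to an error t N^2. *)
Lemma landau_first_difference {R : realType} (F : nat -> R[i]) (t : R) (N : nat) :
  0 <= t -> (0 < N)%N ->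
  (forall k, cabs (F k) <= 1) ->
  (forall k, cabs (F k.+2 - F k.+1 - (F k.+1 - F k)) <= t) ->
  cabs (F 1%N - F 0%N) <= 2 / N%:R + t * N%:R.
Proof.
move=> t0 N0 F1 F2.
set d0 := F 1%N - F 0%N.
have dk k : cabs (F k.+1 - F k - d0) <= k%:R * t.
  elim: k => [|k IH]; first by rewrite mul0r /d0 subrr cabs0.
  apply: le_trans (cabs_dist _ (F k.+1 - F k) _) _.
  by rewrite -natr1 mulrDl mul1r addrC lerD.
have sk k : cabs (F k - F 0%N - k%:R * d0) <= k%:R * (k%:R * t).
  elim: k => [|k IH]; first by rewrite !mul0r !subrr cabs0.
  have -> : F k.+1 - F 0%N - k.+1%:R * d0 =
     (F k - F 0%N - k%:R * d0) + (F k.+1 - F k - d0).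
    by rewrite -natr1; ring.
  apply: le_trans (cabsD _ _) _.
  apply: le_trans (lerD IH (dk k)) _.
  rewrite -natr1; have : 0 <= (k%:R : R) by [].
  move: (k%:R : R) => x x0; nra.
have h : N%:R * cabs d0 <= 2 + N%:R * (N%:R * t).
  have -> : N%:R * cabs d0 = cabs (N%:R * d0).
    by rewrite cabsM cabs_natr.
  have -> : N%:R * d0 = (F N - F 0%N) - (F N - F 0%N - N%:R * d0) by ring.
  apply: le_trans (cabsB _ _) _; apply: lerD; last exact: sk.
  apply: le_trans (cabsB _ _) _.
  by have := F1 N; have := F1 0%N; lra.
have N0' : 0 < (N%:R : R) by rewrite ltr0n.
rewrite -(ler_pM2l N0') mulrDr.
rewrite (_ : N%:R * (2 / N%:R) = 2); last by rewrite mulrC divfK ?gt_eqF.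
by rewrite [t * _]mulrC.
Qed.

Lemma near_geometric_lt (R : realType) (d : R) : 0 < d ->
  exists n, (2^-1 : R) ^+ n < d.
Proof.
move=> d0.
have [n _ /(_ n (leqnn n)) h] : \forall n \near \oo, (2^-1 : R) ^+ n < d.
  by apply: cvgr_lt d0; apply: cvg_expr; rewrite ger0_norm; lra.
by exists n.
Qed.

Lemma le_geometric (R : realType) (T B A : R) : 0 <= A ->
  (forall n, T <= B + 2^-1 ^+ n * A) -> T <= B.
Proof.
move=> A0 key; rewrite leNgt; apply/negP => lt1.
have [|n] := @near_geometric_lt R ((T - B) / (A + 1)); first by rewrite divr_gt0//; lra.
rewrite ltr_pdivlMr; last lra.
have := key n; have : 0 <= 2^-1 ^+ n :> R by rewrite exprn_ge0// invr_ge0.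
move: (2^-1 ^+ n) => q; nra.
Qed.

Section Trig.
Context {R : realType} {G : topologicalZmodType}.
Implicit Types (g : G -> R[i]) (x y : G).

Section CharacterTheory.
Variable (g : G -> R[i]).
Hypothesis cg : character g.

Lemma characterD x y : g (x + y) = g x * g y.
Proof. by case: cg => _ [_ []]. Qed.

Lemma cabs_character x : cabs (g x) = 1.
Proof. by case: cg => _ [_ []]. Qed.

Lemma character0 : g 0 = 1.
Proof.
have g0 : g 0 != 0.
  by apply/eqP => h; have := cabs_character 0; rewrite h cabs0 => /eqP; rewrite eq_sym oner_eq0.
by apply: (mulfI g0); rewrite -characterD addr0 mulr1.
Qed.

Lemma characterN x : g (- x) = (g x)^*%C.
Proof.
have gx : g x != 0.
  by apply/eqP => h; have := cabs_character x; rewrite h cabs0 => /eqP; rewrite eq_sym oner_eq0.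
apply: (mulfI gx); rewrite -characterD subrr character0.
have := cabs_sqr (g x); rewrite cabs_character expr1n; case: (g x) => a b /= h.
by apply/eqP; rewrite eq_complex /=; apply/andP; split; apply/eqP; nra.
Qed.

Lemma ReN_character x : complex.Re (g (- x)) = complex.Re (g x).
Proof. by rewrite characterN; case: (g x). Qed.

Lemma character_sqr1 x : complex.Re (g x) ^+ 2 + complex.Im (g x) ^+ 2 = 1.
Proof. by rewrite -cabs_sqr cabs_character expr1n. Qed.

Lemma cabs_character_sub x y : cabs (g (x + y) - g x) = cabs (g y - 1).
Proof. by rewrite characterD -[X in _ - X]mulr1 -mulrBr cabsM cabs_character mul1r. Qed.

Lemma cabs_characterN_sub1 x : cabs (g (- x) - 1) = cabs (g x - 1).
Proof. by rewrite -(cabs_character_sub x (- x)) subrr character0 cabsBC. Qed.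

Lemma character_mulrn_sub1 x n : cabs (g (x *+ n) - 1) <= n%:R * cabs (g x - 1).
Proof.
elim: n => [|n IH]; first by rewrite mulr0n character0 subrr cabs0 mul0r.
rewrite mulrS -natr1 mulrDl mul1r; apply: le_trans (cabs_dist _ (g (x *+ n)) _) _.
by rewrite [leRHS]addrC lerD// [x + _]addrC cabs_character_sub.
Qed.
End CharacterTheory.

Lemma character_mul g h : character g -> character h -> character (dual_add g h).
Proof.
move=> cg ch; case: (cg) => g1 [g2 _]; case: (ch) => h1 [h2 _].
split; last split; last split.
- move=> x; rewrite /dual_add; under eq_fun do rewrite ReM.
  by apply: cvgB; apply: cvgM; [exact: g1|exact: h1|exact: g2|exact: h2].
- move=> x; rewrite /dual_add; under eq_fun do rewrite ImM.
  by apply: cvgD; apply: cvgM; [exact: g1|exact: h2|exact: g2|exact: h1].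
- by move=> x y; rewrite /dual_add !characterD//; ring.
- by move=> x; rewrite /dual_add cabsM !cabs_character// mulr1.
Qed.

Lemma character_one : character (@dual_zero R G).
Proof.
split; first by move=> x; exact: cvg_cst.
split; first by move=> x; exact: cvg_cst.
by split=> [x y|x]; rewrite /dual_zero ?mulr1// cabs1.
Qed.

Lemma character_conj g : character g -> character (fun x => g (- x)).
Proof.
move=> cg; case: (cg) => g1 [g2 _].
split; last split; last split.
- by move=> x; under eq_fun do rewrite ReN_character//; exact: g1.
- move=> x; have -> : (fun x => complex.Im (g (- x))) = (fun x => - complex.Im (g x)).
    by apply/funext => z; rewrite characterN//; case: (g z).
  by apply: cvgN; exact: g2.
- by move=> x y; rewrite opprD characterD.
- by move=> x; rewrite cabs_character.
Qed.

(** Frequencies may repeat, so that the difference of two polynomials is obtained by concatenating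
    their families. Injectivity is asked only where [span_norm] is met. *)
Definition trig (I : finType) (c : I -> R[i]) (g : I -> G -> R[i]) x : R[i] :=
  \sum_i c i * g i x.

(* [multiplier P h C]: on trigonometric polynomials with frequencies in P, the
   Fourier multiplier h has norm at most C for the uniform norm. *)
Definition multiplier (P : set (G -> R[i])) (h : (G -> R[i]) -> R[i]) (C : R) :=
  forall (I : finType) (c : I -> R[i]) (g : I -> G -> R[i]),
  (forall i, P (g i)) -> forall B, (forall x, cabs (trig c g x) <= B) ->
  forall x, cabs (trig (fun i => c i * h (g i)) g x) <= C * B.

Section Multiplier.
Variable P : set (G -> R[i]).

Lemma eq_multiplier (h k : (G -> R[i]) -> R[i]) C :
  (forall g, P g -> h g = k g) -> multiplier P h C -> multiplier P k C.
Proof.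
move=> hk mh I c g Pg B pB x; have := mh I c g Pg B pB x.
by rewrite /trig; under eq_bigr do rewrite hk//.
Qed.

Lemma multiplierD h k C D : multiplier P h C -> multiplier P k D ->
  multiplier P (fun g => h g + k g) (C + D).
Proof.
move=> mh mk I c g Pg B pB x.
have -> : trig (fun i => c i * (h (g i) + k (g i))) g x =
    trig (fun i => c i * h (g i)) g x + trig (fun i => c i * k (g i)) g x.
  by rewrite /trig -big_split; apply: eq_bigr => i _ /=; ring.
apply: le_trans (cabsD _ _) _; rewrite mulrDl; apply: lerD.
- exact: mh.
- exact: mk.
Qed.

Lemma multiplierM h k C D : multiplier P h C -> multiplier P k D ->
  multiplier P (fun g => h g * k g) (D * C).
Proof.
move=> mh mk I c g Pg B pB x.
have := mk I _ g Pg _ (mh I c g Pg B pB) x; rewrite mulrA => h1.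
by apply: le_trans h1; rewrite /trig; under eq_bigr do rewrite mulrA.
Qed.

Lemma multiplierZ a h C : multiplier P h C ->
  multiplier P (fun g => a * h g) (cabs a * C).
Proof.
move=> mh I c g Pg B pB x.
have -> : trig (fun i => c i * (a * h (g i))) g x =
    a * trig (fun i => c i * h (g i)) g x.
  by rewrite /trig mulr_sumr; apply: eq_bigr => i _ /=; ring.
by rewrite cabsM -mulrA ler_wpM2l ?cabs_ge0//; exact: mh.
Qed.

Lemma multiplier_le h C D : C <= D -> multiplier P h C -> multiplier P h D.
Proof.
move=> CD mh I c g Pg B pB x; apply: le_trans (mh I c g Pg B pB x) _.
by rewrite ler_wpM2r// (le_trans (cabs_ge0 _) (pB 0)).
Qed.

Lemma multiplier_cst0 : multiplier P (fun=> 0) 0.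
Proof.
move=> I c g Pg B pB x; rewrite mul0r /trig big1 ?cabs0// => i _.
by rewrite mulr0 mul0r.
Qed.

Hypothesis charP : P `<=` @character R G.

(** A polynomial has finitely many terms, so convergence at each frequency suffices. The coefficient
    sum [A] depends on the polynomial, but it only multiplies an error that tends to 0. *)
Lemma multiplier_lim (h : nat -> (G -> R[i]) -> R[i]) k C :
  (forall n, multiplier P (h n) C) ->
  (forall n g, P g -> cabs (h n g - k g) <= 2^-1 ^+ n) -> multiplier P k C.
Proof.
move=> mh hk I c g Pg B pB x.
set A := \sum_i cabs (c i).
have A0 : 0 <= A by apply: sumr_ge0 => i _; exact: cabs_ge0.
have key n : cabs (trig (fun i => c i * k (g i)) g x) <= C * B + 2^-1 ^+ n * A.
  apply: le_trans (_ : _ <= cabs (trig (fun i => c i * h n (g i)) g x) +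
    cabs (trig (fun i => c i * h n (g i)) g x - trig (fun i => c i * k (g i)) g x)) _.
    by have := cabs_dist (trig (fun i => c i * k (g i)) g x)
      (trig (fun i => c i * h n (g i)) g x) 0; rewrite !subr0 addrC (cabsBC (trig (fun i => c i * k _) _ _)).
  apply: lerD; first exact: mh.
  rewrite /trig -sumrB mulr_sumr; apply: le_trans (cabs_sum _) _.
  apply: ler_sum => i _; rewrite -mulrBl -mulrBr !cabsM (cabs_character (charP (Pg i))) mulr1 mulrC.
  by rewrite ler_wpM2r ?cabs_ge0// hk.
exact: le_geometric A0 key.
Qed.

(** This is sin^2 of half the argument of [g y]. As a multiplier it is minus a quarter of the second
    difference with step [y], which explains the normalisation: its norm is at most 1. *)
Definition vers y g : R := (1 - complex.Re (g y)) / 2.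

Lemma versE y g : (vers y g)%:C%C = 4^-1 * (2 - g y - (g y)^*%C).
Proof.
rewrite /vers -addrA -opprD addcJ rmorphM rmorphB rmorph1 fmorphV rmorph_nat.
by field.
Qed.

Lemma multiplier_vers y : multiplier P (fun g => (vers y g)%:C%C) 1.
Proof.
move=> I c g Pg B pB x.
have -> : trig (fun i => c i * (vers y (g i))%:C%C) g x =
    4^-1 * ((trig c g x - trig c g (x + y)) + (trig c g x - trig c g (x - y))).
  rewrite /trig -!sumrB -big_split mulr_sumr; apply: eq_bigr => i _ /=.
  have cg := charP (Pg i); rewrite !characterD// characterN// versE.
  by ring.
rewrite cabsM cabs_natrV mul1r.
have := cabsD (trig c g x - trig c g (x + y)) (trig c g x - trig c g (x - y)).
have := cabsB (trig c g x) (trig c g (x + y)); have := cabsB (trig c g x) (trig c g (x - y)).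
have := pB x; have := pB (x + y); have := pB (x - y).
lra.
Qed.

(* Fixed-point iteration for w = (u + w^2) / 2, whose limit is 1 - sqrt (1 - u).
   All coefficients are nonnegative, so it also bounds multiplier norms. *)
Fixpoint sqrt_iter (k : nat) (u : R) : R :=
  if k is k'.+1 then (u + sqrt_iter k' u ^+ 2) / 2 else 0.

(** The bound reproduces itself because (r + r^2) / 2 <= r on [0, 1]. *)
Lemma multiplier_sqrt_iter u r k : 0 <= r <= 1 ->
  multiplier P (fun g => (u g)%:C%C) r ->
  multiplier P (fun g => (sqrt_iter k (u g))%:C%C) r.
Proof.
move=> /andP[r0 r1] mu; elim: k => [|k IH].
  apply: (@multiplier_le _ 0) => //.
  by apply: eq_multiplier multiplier_cst0 => g _.
have := multiplierZ (2^-1) (multiplierD mu (multiplierM IH IH)); rewrite cabs_natrV.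
move=> /multiplier_le /(_ _)/[dup] _ H.
apply: (@eq_multiplier _ _ _ _ (H r _)); last by nra.
move=> g _ /=; rewrite rmorphM rmorphD rmorphXn fmorphV rmorph_nat.
by rewrite expr2 mulrC.
Qed.

(** Here u = 1 - (1 - t)^2, so t is the fixed point 1 - sqrt (1 - u). One iteration multiplies the
    error t - w by (t + w) / 2, which is at most 1/2 since 0 <= w <= t <= 1/2. *)
Lemma sqrt_iter_cvg (t : R) k : 0 <= t <= 2^-1 ->
  0 <= t - sqrt_iter k (2 * t - t ^+ 2) <= 2^-1 ^+ k /\
  0 <= sqrt_iter k (2 * t - t ^+ 2).
Proof.
move=> /andP[t0 t1]; elim: k => [|k [/andP[h1 h2] h3]] /=.
  by rewrite expr0 subr0; split; lra.
move: (sqrt_iter k _) h1 h2 h3 => w h1 h2 h3; have := exprSr (2^-1 : R) k.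
move: (2^-1 ^+ k) (2^-1 ^+ k.+1) h2 => q q' h2 ->; split; last by nra.
apply/andP; split; first by nra.
have -> : t - (2 * t - t ^+ 2 + w ^+ 2) / 2 = (t - w) * ((t + w) / 2) by field.
apply: ler_pM => //; lra.
Qed.

(* vers (2 y) is sin^2 of the angle and 2 (vers y) is 1 - cos, that is
   1 - sqrt (1 - sin^2) as long as the cosine is nonnegative. *)
Lemma multiplier_vers_half y r : 0 <= r <= 1 ->
  (forall g, P g -> 2^-1 <= complex.Re (g y)) ->
  multiplier P (fun g => (vers (y *+ 2) g)%:C%C) r ->
  multiplier P (fun g => (vers y g)%:C%C) (r / 2).
Proof.
move=> r01 Py m2.
suff m1 : multiplier P (fun g => (1 - complex.Re (g y))%:C%C) r.
  have := multiplierZ (2^-1) m1; rewrite cabs_natrV [_ * r]mulrC; apply: eq_multiplier => g _.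
  by rewrite /vers rmorphM fmorphV rmorph_nat mulrC.
apply: (multiplier_lim (fun k => multiplier_sqrt_iter k r01 m2)) => k g Pg.
rewrite -rmorphB cabs_real distrC.
have cg := charP Pg; have := character_sqr1 cg y => h.
have h1 := Py g Pg.
have [|] := @sqrt_iter_cvg (1 - complex.Re (g y)) k.
  apply/andP; split; last lra.
  by have := ler_Re_cabs (g y); rewrite cabs_character// ler_norml => /andP[]; lra.
have -> : 2 * (1 - complex.Re (g y)) - (1 - complex.Re (g y)) ^+ 2 = vers (y *+ 2) g.
  rewrite /vers mulr2n characterD// ReM; move: (complex.Re (g y)) (complex.Im (g y)) h => a b h.
  have -> : b * b = 1 - a * a by rewrite -h; ring.
  by field.
by move=> /andP[a b] _; rewrite ger0_norm.
Qed.

Lemma multiplier_vers_pow n : forall y,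
  (forall g j, P g -> (j < n)%N -> 2^-1 <= complex.Re (g (y *+ (2 ^ j)))) ->
  multiplier P (fun g => (vers y g)%:C%C) (2^-1 ^+ n).
Proof.
elim: n => [|n IH] y h; first exact: multiplier_vers.
rewrite exprSr; apply: multiplier_vers_half.
- by rewrite exprn_ge0 ?invr_ge0// exprn_ile1//; lra.
- by move=> g Pg; have := h g 0%N Pg isT; rewrite expn0 mulr1n.
- apply: IH => g j Pg jn; rewrite -mulrnA -expnS; exact: h.
Qed.

End Multiplier.

Lemma trig_equicontinuous (eps : R) : 0 < eps -> exists2 eta : R, 0 < eta &
  forall (I : finType) (c : I -> R[i]) (g : I -> G -> R[i]) (y : G),
  (forall i, character (g i)) -> (forall i, cabs (g i y - 1) <= eta) ->
  (forall x, cabs (trig c g x) <= 1) ->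
  forall x, cabs (trig c g (x + y) - trig c g x) <= eps.
Proof.
move=> e0.
(* The target is the bound 2 / N + t N of [landau_first_difference]. N is fixed first, then n makes
   t = 4 * 2^-n small against it; the factor 4 undoes the normalisation of [vers]. *)
have [N N0 Ne] : exists2 N : nat, (0 < N)%N & 2 / N%:R <= eps / 2.
  exists (Num.bound (4 / eps)).
    rewrite -(ltr_nat R); apply: le_lt_trans (archi_boundP _); rewrite divr_ge0//; lra.
  have h : 4 / eps < (Num.bound (4 / eps))%:R.
    by apply: archi_boundP; rewrite divr_ge0//; lra.
  rewrite ler_pdivrMr; last by apply: le_lt_trans h; rewrite divr_ge0//; lra.
  by move: h; rewrite ltr_pdivrMr//; lra.
have [n nh] : exists n, 4 * 2^-1 ^+ n * N%:R <= eps / 2.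
  have [|n] := @near_geometric_lt R (eps / 2 / (4 * N%:R)).
    by rewrite !divr_gt0// mulr_gt0// ltr0n.
  rewrite ltr_pdivlMr ?mulr_gt0 ?ltr0n// => h; exists n.
  by rewrite [4 * _]mulrC -mulrA ltW.
(* The distance from [g y] to 1 grows at most 2^j times at [y *+ 2 ^ j]. For j < n it stays below
   1/2, so the cosine stays above 1/2 and all n halvings are allowed. *)
exists (2^-1 ^+ n.+1); first by rewrite exprn_gt0; lra.
move=> I c g y cg gy pB x.
pose P : set (G -> R[i]) := range g.
have charP : P `<=` @character R G by move=> _ [i _ <-].
have mP : multiplier P (fun g => (vers y g)%:C%C) (2^-1 ^+ n).
  apply: multiplier_vers_pow => // _ j [i _ <-] jn.
  have h1 := character_mulrn_sub1 (cg i) y (2 ^ j).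
  have h2 : (2 ^ j)%:R * cabs (g i y - 1) <= 2^-1.
    apply: le_trans (_ : 2 ^+ j * 2^-1 ^+ n.+1 <= _).
      by rewrite natrX ler_wpM2l// exprn_ge0.
    rewrite -(ler_pM2l (exprn_gt0 j (_ : 0 < 2^-1 :> R))) ?invr_gt0//.
    rewrite mulrA -exprMn mulVf// expr1n mul1r -exprSr.
    by apply: ler_wiXn2l; [lra|lra|exact: leqW].
  have := ler_Re_cabs (g i (y *+ 2 ^ j) - 1); rewrite ReD ReN /= ler_norml => /andP[].
  by lra.
have := @landau_first_difference R (fun k => trig c g (x + y *+ k)) (4 * 2^-1 ^+ n) N.
rewrite mulr1n mulr0n addr0 => L; apply: le_trans (L _ N0 _ _) _.
- by rewrite mulr_ge0// exprn_ge0; lra.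
- by move=> k; exact: pB.
- move=> k; have := mP I c g (imageT g) 1 pB (x + y *+ k.+1).
  rewrite mulr1; set T := trig _ _ _ => hT.
  have -> : trig c g (x + y *+ k.+2) - trig c g (x + y *+ k.+1) -
     (trig c g (x + y *+ k.+1) - trig c g (x + y *+ k)) = - (4 * T).
    rewrite /T /trig mulr_sumr -!sumrB -sumrN; apply: eq_bigr => i _.
    have -> : x + y *+ k.+2 = x + y *+ k.+1 + y by rewrite (mulrSr _ k.+1) addrA.
    have -> : x + y *+ k = x + y *+ k.+1 - y by rewrite (mulrSr _ k) addrA addrK.
    move: (x + y *+ k.+1) => z; rewrite !characterD// characterN// versE.
    by field.
  rewrite cabsN cabsM.
  by rewrite cabs_natr ler_wpM2l.
- by move: Ne nh; lra.
Qed.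
End Trig.

(** * Topology of the group *)

(** Finite subcovers in the shape used by [dual_compact], over an arbitrary index type. The
    near-covering property is applied along the filter of large finite index sets. *)
Lemma compact_finite_cover (T : topologicalType) (K : set T) (I : Type) (F : I -> set T) :
  compact K -> (forall x, K x -> exists i, nbhs x (F i)) ->
  exists D : set I, finite_set D /\ K `<=` \bigcup_(i in D) F i.
Proof.
move=> cK KF.
pose B := filter_from (@finite_set I) (fun D => [set D' | finite_set D' /\ D `<=` D']).
have FB : Filter B.
  apply: filter_from_filter; first by exists set0.
  move=> D1 D2 f1 f2; exists (D1 `|` D2); first by rewrite finite_setU.
  by move=> D [fD DD]; split; split => // i Di; apply: DD; [left|right].
have [] := (@compact_near_coveringP T K).1 cK (set I) B
  (fun D x => (\bigcup_(i in D) F i) x) FB.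
  move=> x Kx; have [i Fi] := KF x Kx.
  exists (F i, [set D | finite_set D /\ [set i] `<=` D]) => /=.
    by split => //; exists [set i].
  by move=> [y D] /= [Fy [_ iD]]; exists i => //; exact: iD.
by move=> D fD DK; exists D; split => //; exact: (DK D (conj fD (@subset_refl _ D))).
Qed.

Section GroupTopology.
Context {G : topologicalZmodType}.

Lemma nbhs0_translate (x : G) (W : set G) : nbhs 0 W -> nbhs x [set z | W (z - x)].
Proof.
move=> W0; have c : (fun z => z - x) @ x --> (0 : G).
  rewrite -[X in _ --> X](subrr x).
  apply: (@continuous_comp _ _ _ (fun z : G => (z, x)) (fun z : G * G => z.1 - z.2)).
    by apply: cvg_pair; [exact: cvg_id|exact: cvg_cst].
  exact: sub_continuous.
exact: c.
Qed.

Lemma nbhs0_opp (W : set G) : nbhs 0 W -> nbhs 0 [set z : G | W (- z)].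
Proof. by move=> W0; have := @opp_continuous G 0; rewrite /continuous_at /= oppr0; apply. Qed.


Lemma open_translate (x : G) (U : set G) : open U -> open [set z | U (z - x)].
Proof.
apply: open_comp => z _.
apply: (@continuous_comp _ _ _ (fun z : G => (z, x)) (fun z : G * G => z.1 - z.2)).
  by apply: cvg_pair; [exact: cvg_id|exact: cvg_cst].
exact: sub_continuous.
Qed.


Lemma compact_opp (K : set G) : compact K -> compact [set - y | y in K].
Proof.
by apply: continuous_compact; apply: continuous_subspaceT => z; exact: opp_continuous.
Qed.

Lemma compact_cover_translates (K W : set G) : compact K -> nbhs 0 W ->
  exists s : seq G, forall x, K x -> exists2 y, y \in s & W (x - y).
Proof.
move=> cK W0.
have [x _|D [/finite_seqP[s ->] KD]] :=
    @compact_finite_cover _ K G (fun x => [set z | W (z - x)]) cK.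
  by exists x; exact: nbhs0_translate.
by exists s => x /KD [y ys Wxy]; exists y.
Qed.

Lemma compact_thickening (K U : set G) : compact K -> open U -> K `<=` U ->
  exists2 W, nbhs (0 : G) W & forall x y, K x -> W y -> U (x + y).
Proof.
move=> cK oU KU.
have near_cov : forall x, K x -> \forall x' \near x & y \near (0 : G), U (x' + y).
  move=> x Kx; have := @add_continuous G (x, 0); rewrite /continuous_at /= addr0.
  by apply; apply: open_nbhs_nbhs; split => //; exact: KU.
exists [set y | K `<=` fun x => U (x + y)] => //.
  exact: ((@compact_near_coveringP G K).1 cK G (nbhs 0) (fun y x => U (x + y)) _ near_cov).
by move=> x y Kx; exact.
Qed.

Lemma nbhs0_compact : locally_compact [set: G] ->
  exists2 K : set G, compact K & nbhs 0 K.
Proof.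
move=> /(_ 0 I) [U U0 [cU _]]; exists U => //.
by move: (U0 : nbhs (0 : G) [set x | setT x -> U x]); apply: filterS => x; apply.
Qed.
End GroupTopology.

(** * Topology of the dual *)

Section DualTopology.
Context {R : realType} {G : topologicalZmodType}.
Implicit Types (g h : G -> R[i]) (A B : set (G -> R[i])).

Definition dual_opp g : G -> R[i] := fun x => g (- x).

Lemma character_mulN g x : character g -> g x * g (- x) = 1.
Proof. by move=> cg; rewrite -characterD// subrr character0. Qed.

Lemma dual_addK g h : character h -> dual_add (dual_add g h) (dual_opp h) = g.
Proof.
by move=> ch; apply/funext => x; rewrite /dual_add/dual_opp -mulrA character_mulN// mulr1.
Qed.

Lemma dual_subK g h : character h -> dual_add (dual_add g (dual_opp h)) h = g.
Proof.
move=> ch; apply/funext => x; rewrite /dual_add/dual_opp -mulrA [h _ * _]mulrC.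
by rewrite character_mulN// mulr1.
Qed.

Lemma dual_add0 g : dual_add (@dual_zero R G) g = g.
Proof. by apply/funext => x; rewrite /dual_add mul1r. Qed.

Lemma dual_shift_character A g :
  A `<=` @dual R G -> character g -> dual_shift A g `<=` @dual R G.
Proof. by move=> Ac cg _ [v [/Ac cv ->]]; exact: character_mul. Qed.

Lemma dual_open_shift A g : dual_open A -> character g -> dual_open (dual_shift A g).
Proof.
move=> [Ac Ao] cg; split; first exact: dual_shift_character.
move=> _ [v [Av ->]]; have [K [e [cK e0 KA]]] := Ao v Av.
exists K, e; split => // h [ch hK]; exists (dual_add h (dual_opp g)); split; last first.
  by rewrite dual_subK.
apply: KA; split; first by apply: character_mul => //; exact: character_conj.
move=> x Kx; apply: le_lt_trans (hK x Kx).
rewrite -[X in _ <= X]mulr1 -(cabs_character cg (- x)) -cabsM mulrBl /dual_add.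
by rewrite -(mulrA (v x)) character_mulN// mulr1.
Qed.

Lemma dual_compact_shift A g : dual_compact A -> character g ->
  dual_compact (dual_shift A g).
Proof.
move=> [Ac Acpt] cg; split; first exact: dual_shift_character.
move=> I F oF AF; have cg' := character_conj cg.
have [||D [fD AD]] := Acpt I (fun i => dual_shift (F i) (dual_opp g)).
- by move=> i; exact: dual_open_shift.
- move=> h Ah; have [|i _ Fi] := AF (dual_add h g); first by exists h.
  by exists i => //; exists (dual_add h g); split; rewrite // dual_addK.
exists D; split => // _ [v [/AD[i Di [w [Fw ->]]] ->]].
by exists i => //; rewrite dual_subK.
Qed.

Lemma dual_compact_bigcup (I : Type) (D : set I) (F : I -> set (G -> R[i])) :
  finite_set D -> (forall i, D i -> dual_compact (F i)) ->
  dual_compact (\bigcup_(i in D) F i).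
Proof.
move=> fD cF; split; first by move=> g [i Di]; exact: (cF i Di).1.
move=> J H oH FH.
have [E hE] : {E : I -> set J & forall i, D i ->
    finite_set (E i) /\ F i `<=` \bigcup_(j in E i) H j}.
  apply: (@choice _ _ (fun i E => D i -> finite_set E /\ F i `<=` \bigcup_(j in E) H j)).
  move=> i; have [Di|nDi] := pselect (D i); last by exists set0.
  have [|E [fE FE]] := (cF i Di).2 J H oH; last by exists E.
  by move=> g Fg; apply: FH; exists i.
exists (\bigcup_(i in D) E i); split.
  by apply: bigcup_finite => // i Di; exact: (hE i Di).1.
by move=> g [i Di /(hE i Di).2[j Ej Hj]]; exists j => //; exists i.
Qed.

Lemma dual_compactU A B : dual_compact A -> dual_compact B -> dual_compact (A `|` B).
Proof.
move=> cA cB; rewrite (_ : _ `|` _ = \bigcup_(b in [set: bool]) if b then A else B).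
  by apply: dual_compact_bigcup => // -[].
apply/seteqP; split => [g [Ag|Bg]|g [[] _]]; by [exists true|exists false|left|right].
Qed.

(** The slack [e'] keeps the supremum over K strictly below e, so openness follows without attaining
    a maximum on K. *)
Lemma dual_open_ball g (K : set G) (e : R) : compact K ->
  dual_open [set h | character h /\
     exists2 e', e' < e & forall x, K x -> cabs (h x - g x) <= e'].
Proof.
move=> cK; split; first by move=> h [].
move=> h [ch [e' e'e hK]]; exists K, ((e - e') / 2); split => //.
  by rewrite divr_gt0// subr_gt0.
move=> k [ck kK]; split => //; exists ((e + e') / 2); first lra.
move=> x Kx; apply: le_trans (cabs_dist _ (h x) _) _.
by have := kK x Kx; have := hK x Kx; lra.
Qed.

(** For characters, equicontinuity at 0 is equicontinuity everywhere, by [cabs_character_sub]. *)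
Definition equicontinuous0 A := forall e : R, 0 < e ->
  exists2 W, nbhs (0 : G) W & forall g y, A g -> W y -> cabs (g y - 1) <= e.

Lemma equicontinuous0_shift A B : A `<=` @dual R G ->
  equicontinuous0 A -> equicontinuous0 B ->
  equicontinuous0 (\bigcup_(g in B) dual_shift A g).
Proof.
move=> Ac eA eB e e0; have e2 : 0 < e / 2 by lra.
have [W1 n1 h1] := eA _ e2; have [W2 n2 h2] := eB _ e2.
exists (W1 `&` W2); first exact: filterI.
move=> _ y [g Bg [v [Av ->]]] [y1 y2]; rewrite /dual_add.
apply: le_trans (cabs_dist _ (v y) _) _.
have := h1 _ _ Av y1; have := h2 _ _ Bg y2.
rewrite -[X in _ * _ - X]mulr1 -mulrBr cabsM (cabs_character (Ac _ Av)).
lra.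
Qed.

Lemma character_near g (e : R) : character g -> 0 < e ->
  nbhs (0 : G) [set y | cabs (g y - 1) < e].
Proof.
move=> cg e0; case: (cg) => c1 [c2 _].
have e2 : 0 < e / 2 by lra.
have := c1 0; have := c2 0; rewrite /continuous_at /= character0//= => /cvgr_dist_lt /(_ _ e2) h2.
move=> /cvgr_dist_lt /(_ _ e2) h1; near=> y.
apply: le_lt_trans (ler_cabs_ReIm _) _; rewrite ReD ImD ReN ImN /= distrC.
rewrite [X in _ + X]distrC.
have : `|1 - complex.Re (g y)| < e / 2 by near: y; exact: h1.
have : `|0 - complex.Im (g y)| < e / 2 by near: y; exact: h2.
lra.
Unshelve. all: by end_near. Qed.

(** On a compact neighbourhood of 0 the set has a finite net for the uniform distance, and finitely
    many characters share a neighbourhood of continuity at 0. *)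
Lemma dual_compact_equicontinuous0 A : locally_compact [set: G] ->
  dual_compact A -> equicontinuous0 A.
Proof.
move=> lcG [Ac Acpt] e e0; have [K cK K0] := nbhs0_compact lcG.
pose F g := [set h | character h /\
     exists2 e', e' < e / 2 & forall x, K x -> cabs (h x - g x) <= e'].
have [||D [fD AD]] := Acpt {g | A g} (fun i => F (sval i)).
- by move=> g; exact: dual_open_ball.
- move=> g Ag; exists (exist _ g Ag) => //; split; first exact: Ac.
  by exists 0; [lra|move=> x _; rewrite subrr cabs0].
have cval (g : {g | A g}) : character (sval g) by apply: Ac; exact: svalP.
have [B hB] : exists B : {fset (G -> R[i])}, [set sval i | i in D] = [set` B].
  by apply/finite_fsetP; exact: finite_image.
exists (K `&` \bigcap_(g in [set` B]) [set y | cabs (g y - 1) < e / 2]).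
  apply: filterI => //; apply: filter_bigI => g gB.
  have [i _ <-] : [set sval i | i in D] g by rewrite hB.
  by apply: character_near => //; lra.
move=> h y /AD[g Dg [ch [e' e'e hK]]] [Ky gy].
apply: le_trans (cabs_dist _ (sval g y) _) _.
by have := hK y Ky; have := gy (sval g); rewrite -hB /= => /(_ (imageP _ Dg)); lra.
Qed.

(** A finite union of translates of the closure of V works: its interior contains the corresponding
    translates of V, and these are dense in it. *)
Lemma regular_compact_cover (V : set (G -> R[i])) A :
  dual_open V -> V (@dual_zero R G) -> dual_compact (dual_closure V) -> dual_compact A ->
  exists Om, [/\ dual_compact Om, dual_interior Om !=set0,
    Om `<=` dual_closure (dual_interior Om) & A `<=` Om].
Proof.
move=> oV V0 cV [Ac Acpt].
have VV : V `<=` dual_closure V.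
  by move=> g Vg; split; [exact: oV.1|move=> U _ Ug; exists g].
have [||D [fD AD]] := Acpt {g | @dual R G g} (fun i => dual_shift V (sval i)).
- by move=> g; apply: dual_open_shift => //; exact: (svalP g).
- move=> g Ag; exists (exist _ g (Ac _ Ag)) => //=.
  by exists (@dual_zero R G); rewrite dual_add0.
(* The trivial character is added so that the interior is nonempty even when [A] is empty. *)
pose D' := [set sval i | i in D] `|` [set @dual_zero R G].
have cD' g : D' g -> character g.
  by move=> [[h _ <-]|->]; [exact: (svalP h)|exact: character_one].
pose Om := \bigcup_(g in D') dual_shift (dual_closure V) g.
have VOm g : D' g -> dual_shift V g `<=` dual_interior Om.
  move=> D'g h Vh; exists (dual_shift V g); split => //.
    by apply: dual_open_shift => //; exact: cD'.
  by move=> _ [v [/VV Vv ->]]; exists g => //; exists v.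
exists Om; split.
- apply: dual_compact_bigcup; first by rewrite finite_setU; split => //; exact: finite_image.
  by move=> g /cD' cg; exact: dual_compact_shift.
- exists (dual_add (@dual_zero R G) (@dual_zero R G)).
  by apply: (VOm (@dual_zero R G)); [right|exists (@dual_zero R G)].
- move=> _ [g D'g [v [[cv Vv] ->]]]; have cg := cD' _ D'g; split.
    exact: character_mul.
  move=> U oU Ug.
  have [||w [[u [Uu wu]] Vw]] := Vv (dual_shift U (dual_opp g)).
  + by apply: dual_open_shift => //; exact: character_conj.
  + by exists (dual_add v g); rewrite dual_addK.
  exists (dual_add w g); split; first by rewrite wu dual_subK.
  by apply: (VOm g) => //; exists w.
- move=> g /AD[h Dh [v [Vv ->]]]; exists (sval h); first by left; exists h.
  by exists v; split => //; exact: VV.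
Qed.

End DualTopology.

(** * Compact sets of characters *)

Lemma filter_forall_seq (T : Type) (F : set_system T) (I : eqType) (s : seq I) (A : I -> set T) :
  Filter F -> (forall i, i \in s -> F (A i)) -> F [set x | forall i, i \in s -> A i x].
Proof.
move=> FF; elim: s => [|i s IH] FA; first by apply: filterS filterT => x _ i; rewrite in_nil.
have h1 := FA i (mem_head _ _).
have {}IH := IH (fun j js => FA j (mem_behead (s := i :: s) js)).
apply: filterS2 h1 IH => x Ai As j; rewrite inE => /orP[/eqP->//|]; exact: As.
Qed.

Section Ascoli.
Context {R : realType} {G : topologicalZmodType}.
Implicit Types (g : G -> R[i]) (x y : G).
Import ArrowAsProduct.

Lemma cabs_le_sqr (z : R[i]) (e : R) : 0 <= e ->
  (cabs z <= e) = (complex.Re z ^+ 2 + complex.Im z ^+ 2 <= e ^+ 2).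
Proof. by move=> e0; rewrite -cabs_sqr ler_pXn2r// nnegrE cabs_ge0. Qed.

Lemma cabs_eq1 (z : R[i]) : complex.Re z ^+ 2 + complex.Im z ^+ 2 = 1 -> cabs z = 1.
Proof.
rewrite -cabs_sqr => /eqP; rewrite sqrf_eq1 => /orP[/eqP//|/eqP h].
by have := cabs_ge0 z; rewrite h; lra.
Qed.

Lemma character_equicontinuous0 g :
  (forall x y, g (x + y) = g x * g y) -> (forall x, cabs (g x) = 1) ->
  (forall e : R, 0 < e -> nbhs (0 : G) [set y | cabs (g y - 1) <= e]) -> character g.
Proof.
move=> gD g1 gc; suff h x (e : R) : 0 < e -> \forall z \near x, cabs (g x - g z) < e.
  split; last split => //; move=> x; apply/cvgrPdist_lt => e e0;
    (apply: filterS (h x e e0) => z; apply: le_lt_trans).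
  - by apply: le_trans (ler_Re_cabs _); rewrite ReD ReN.
  - by apply: le_trans (ler_Im_cabs _); rewrite ImD ImN.
move=> e0; have e2 : 0 < e / 2 by lra.
apply: filterS (nbhs0_translate x (gc _ e2)) => z /= hz.
have -> : g z = g x * g (z - x) by rewrite -gD addrC subrK.
by rewrite -[X in cabs (X - _)]mulr1 -mulrBr cabsM g1 mul1r cabsBC; lra.
Qed.

Lemma closed_le_continuous (T : topologicalType) (u : T -> R) (r : R) :
  continuous u -> closed [set t | u t <= r].
Proof.
move=> cu; apply: (@preimage_closed _ _ u [set s : R | s <= r]); last exact: closed_le.
by move=> t _; exact: cu.
Qed.

Lemma closed_eq_continuous (T : topologicalType) (u : T -> R) (r : R) :
  continuous u -> closed [set t | u t = r].
Proof.
move=> cu; apply: (@preimage_closed _ _ u [set s : R | s = r]); last exact: closed_eq.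
by move=> t _; exact: cu.
Qed.

Lemma continuous_sqrD (T : topologicalType) (u v : T -> R) :
  continuous u -> continuous v -> continuous (fun t => u t ^+ 2 + v t ^+ 2).
Proof.
move=> cu cv t; under eq_fun do rewrite !expr2.
by apply: cvgD; apply: cvgM; [exact: cu|exact: cu|exact: cv|exact: cv].
Qed.

Lemma continuous_cross (T : topologicalType) (w a b c d : T -> R) :
  continuous w -> continuous a -> continuous b -> continuous c -> continuous d ->
  continuous (fun t => w t - (a t * b t + c t * d t)).
Proof.
move=> cw ca cb cc cd t; apply: cvgB; first exact: cw.
by apply: cvgD; apply: cvgM; [exact: ca|exact: cb|exact: cc|exact: cd].
Qed.

Lemma continuous_crossB (T : topologicalType) (w a b c d : T -> R) :
  continuous w -> continuous a -> continuous b -> continuous c -> continuous d ->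
  continuous (fun t => w t - (a t * b t - c t * d t)).
Proof.
move=> cw ca cb cc cd t; apply: cvgB; first exact: cw.
by apply: cvgB; apply: cvgM; [exact: ca|exact: cb|exact: cc|exact: cd].
Qed.

Let coords := (G * bool)%type -> R.
(* Real and imaginary parts are stored as separate coordinates, so that Tychonoff's
   theorem applies to the cube of real functions on G * bool. *)
Definition of_coords (f : (G * bool)%type -> R) : G -> R[i] :=
  fun x => Complex (f (x, true)) (f (x, false)).

(** [W] is a prescribed modulus of equicontinuity at 0; the nonstrict inequality survives pointwise
    limits. *)
Definition equicontinuous_characters (W : R -> set G) : set (G -> R[i]) :=
  [set g | character g /\ forall e : R, 0 < e -> forall y, W e y -> cabs (g y - 1) <= e].

(** Continuity is not a closed condition for pointwise convergence. It is recovered from the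
    modulus, E4, while multiplicativity (E1 and E2), unit modulus (E3) and E4 itself are closed, so
    the set is closed in a compact cube. *)
Lemma compact_of_coords (W : R -> set G) : (forall e : R, 0 < e -> nbhs (0 : G) (W e)) ->
  compact (of_coords @^-1` equicontinuous_characters W : set (forall _ : G * bool, R)).
Proof.
move=> nW.
pose E1 : set coords := \bigcap_(p in [set: G * G])
  [set f | f (p.1 + p.2, true) - (f (p.1, true) * f (p.2, true) - f (p.1, false) * f (p.2, false)) = 0].
pose E2 : set coords := \bigcap_(p in [set: G * G])
  [set f | f (p.1 + p.2, false) - (f (p.1, true) * f (p.2, false) + f (p.1, false) * f (p.2, true)) = 0].
pose E3 : set coords := \bigcap_(x in [set: G]) [set f | f (x, true) ^+ 2 + f (x, false) ^+ 2 = 1].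
pose E4 : set coords := \bigcap_(p in [set p : R * G | 0 < p.1 /\ W p.1 p.2])
  [set f | (f (p.2, true) - 1) ^+ 2 + f (p.2, false) ^+ 2 <= p.1 ^+ 2].
pose cube : set coords := [set f | forall i, `[-1, 1]%classic (f i)].
have ccube : compact cube.
  by apply: (@tychonoff (G * bool)%type (fun=> R) (fun=> `[-1, 1]%classic)) => i; exact: segment_compact.
have pc (i : G * bool) : continuous (fun f : coords => f i).
  exact: (@proj_continuous (G * bool)%type (fun=> R) i).
have -> : of_coords @^-1` equicontinuous_characters W = cube `&` (E1 `&` E2 `&` E3 `&` E4).
  apply/seteqP; split=> f /=.
    move=> [cf fW]; split; [|split; [split; [split|]|]].
    - move=> [x b]; have h := cabs_character cf x; rewrite /= in_itv /= -ler_norml.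
      case: b; [have := ler_Re_cabs (of_coords f x)|have := ler_Im_cabs (of_coords f x)];
      by rewrite h.
    - move=> [x y] _ /=; have := characterD cf x y.
      by rewrite /of_coords => -[-> _]; rewrite subrr.
    - move=> [x y] _ /=; have := characterD cf x y.
      by rewrite /of_coords => -[_ ->] /=; ring.
    - by move=> x _ /=; exact: (character_sqr1 cf x).
    - move=> [e y] [/= e0 Wy]; have := fW e e0 y Wy.
      by rewrite cabs_le_sqr ?(ltW e0)// ReD ReN ImD ImN /= subr0.
  move=> [_ [[[f1 f2] f3] f4]].
  have fW (e : R) : 0 < e -> forall y, W e y -> cabs (of_coords f y - 1) <= e.
    move=> e0 y Wy; have := f4 (e, y) (conj e0 Wy).
    by rewrite cabs_le_sqr ?(ltW e0)// ReD ReN ImD ImN /= subr0.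
  split=> //; apply: character_equicontinuous0.
  - move=> x y; apply/eqP; rewrite eq_complex ReM ImM /=; apply/andP; split; apply/eqP.
    + by have /eqP := f1 (x, y) I; rewrite subr_eq0 => /eqP.
    + by have /eqP := f2 (x, y) I; rewrite subr_eq0 => /eqP.
  - by move=> x; apply: cabs_eq1; exact: (f3 x I).
  - by move=> e e0; apply: filterS (nW e e0) => y; exact: fW.
apply: compact_closedI => //.
apply: closedI; last first.
  apply: closed_bigI => -[e y] _ /=; apply: closed_le_continuous.
  apply: (@continuous_sqrD _ (fun f : coords => f (y, true) - 1) _ _ (pc (y, false))) => f.
  by apply: (@cvgB R R^o coords (nbhs f)); [exact: (pc (y, true))|exact: cvg_cst].
apply: closedI; last first.
  apply: closed_bigI => x _ /=; apply: closed_eq_continuous.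
  exact: continuous_sqrD (pc (x, true)) (pc (x, false)).
apply: closedI; apply: closed_bigI => -[x y] _ /=; apply: closed_eq_continuous.
- exact: continuous_crossB (pc _) (pc _) (pc _) (pc _) (pc _).
- exact: continuous_cross (pc _) (pc _) (pc _) (pc _) (pc _).
Qed.

(** On an equicontinuous set the product topology is as fine as the compact-open one: closeness at
    the finitely many points of [s] gives closeness on K, at a cost of e/4 for each of the two
    characters and e/4 for the coordinates. *)
Lemma dual_compact_equicontinuous_characters (W : R -> set G) :
  (forall e : R, 0 < e -> nbhs (0 : G) (W e)) -> dual_compact (equicontinuous_characters W).
Proof.
move=> nW; split=> [g []//|I F oF EF].
have [|D [fD ED]] := @compact_finite_cover _ _ I
    (fun i => [set f : coords | equicontinuous_characters W (of_coords f) -> F i (of_coords f)])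
    (compact_of_coords nW).
  move=> f Ef; have [i _ Fi] := EF _ Ef; exists i.
  have [K [e [cK e0 KF]]] := (oF i).2 _ Fi.
  have e4 : 0 < e / 4 by lra.
  have [s sK] := compact_cover_translates cK (nW _ e4).
  have near_s : nbhs f [set f' : coords | forall y, y \in s ->
      `|f (y, true) - f' (y, true)| < e / 8 /\ `|f (y, false) - f' (y, false)| < e / 8].
    apply: filter_forall_seq => y ys; apply: filterI.
    - have := (@proj_continuous (G * bool)%type (fun=> R) (y, true)) f.
      by move=> /cvgr_dist_lt; apply; lra.
    - have := (@proj_continuous (G * bool)%type (fun=> R) (y, false)) f.
      by move=> /cvgr_dist_lt; apply; lra.
  apply: filterS near_s => f' hf' [cf' Wf']; apply: KF; split => // x Kx.
  have [y ys Wxy] := sK x Kx; have [h1 h2] := hf' y ys.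
  have [cf Wf] := Ef.
  have h3 : cabs (of_coords f y - of_coords f' y) < e / 4.
    apply: le_lt_trans (ler_cabs_ReIm _) _; rewrite ReD ReN ImD ImN /=.
    by move: h1 h2; lra.
  have h4 := Wf _ e4 _ Wxy; have h5 := Wf' _ e4 _ Wxy.
  have -> : x = y + (x - y) by rewrite addrC subrK.
  apply: le_lt_trans (cabs_dist _ (of_coords f' y) _) _.
  rewrite (cabs_character_sub cf').
  apply: le_lt_trans (lerD h5 (cabs_dist _ (of_coords f y) _)) _.
  rewrite (cabsBC (of_coords f y) (of_coords f _)) (cabs_character_sub cf) (cabsBC (of_coords f' y)).
  by move: h3 h4; lra.
exists D; split => // g Eg.
pose f (p : G * bool) : R := if p.2 then complex.Re (g p.1) else complex.Im (g p.1).
have fg : of_coords f = g by apply/funext => x; rewrite /of_coords /f /=; case: (g x).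
have [|i Di] := ED f; first by rewrite /= fg.
by rewrite /= fg => /(_ Eg); exists i.
Qed.

End Ascoli.

(** * Smallness of local norms at infinity *)

Section TightFunctional.
Context {R : realType} {G : topologicalZmodType}.
Implicit Types (phi : (G -> R[i]) -> R[i]) (x y : G).

(* For p = trig c g this is the sum of \hat p (gamma) phi (gamma) over the frequencies gamma. *)
Definition pairing (I : finType) (c : I -> R[i]) (g : I -> G -> R[i]) phi : R[i] :=
  \sum_i c i * phi (g i).

(** For the transform of a measure, M is proportional to the total mass, and K, up to reflection,
    carries all but a mass of order eps. *)
Definition tight_functional phi := exists2 M : R, 0 <= M &
  forall eps : R, 0 < eps -> exists2 K : set G, compact K &
  forall (I : finType) (c : I -> R[i]) (g : I -> G -> R[i]),
  (forall i, character (g i)) -> forall B eta : R, 0 <= eta ->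
  (forall x, cabs (trig c g x) <= B) -> (forall x, K x -> cabs (trig c g x) <= eta) ->
  cabs (pairing c g phi) <= M * eta + eps * B.

Definition vanishes_at_infinity phi := forall e : R, 0 < e ->
  exists2 K, dual_compact K & forall g, character g -> ~ K g -> cabs (phi g) < e.

Lemma big_sum_type (I J : finType) (F : I + J -> R[i]) :
  \sum_k F k = \sum_i F (inl i) + \sum_j F (inr j).
Proof. by rewrite big_sumType. Qed.

Definition sum_family (I J : finType) (T : Type) (u : I -> T) (v : J -> T) (k : I + J) : T :=
  match k with inl i => u i | inr j => v j end.

Lemma trig_mul_character (I : finType) (c : I -> R[i]) (v : I -> G -> R[i]) (g : G -> R[i]) x :
  trig c (fun i => dual_add (v i) g) x = trig c v x * g x.
Proof. by rewrite /trig mulr_suml; apply: eq_bigr => i _; rewrite mulrA. Qed.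

Lemma cabs_trig_mul_character (I : finType) (c : I -> R[i]) (v : I -> G -> R[i]) g x :
  character g -> cabs (trig c (fun i => dual_add (v i) g) x) = cabs (trig c v x).
Proof. by move=> cg; rewrite trig_mul_character cabsM (cabs_character cg) mulr1. Qed.

Lemma trig_sub (I J : finType) (c : I -> R[i]) (d : J -> R[i]) (g : I -> G -> R[i])
    (h : J -> G -> R[i]) x :
  trig (sum_family c (fun j => - d j)) (sum_family g h) x = trig c g x - trig d h x.
Proof.
by rewrite /trig big_sum_type -sumrN; congr (_ + _); apply: eq_bigr => j _; rewrite /= mulNr.
Qed.

Lemma pairing_sub (I J : finType) (c : I -> R[i]) (d : J -> R[i]) (g : I -> G -> R[i])
    (h : J -> G -> R[i]) phi :
  pairing (sum_family c (fun j => - d j)) (sum_family g h) phi =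
  pairing c g phi - pairing d h phi.
Proof.
by rewrite /pairing big_sum_type -sumrN; congr (_ + _); apply: eq_bigr => j _; rewrite /= mulNr.
Qed.

Lemma dual_compact0 : dual_compact (set0 : set (G -> R[i])).
Proof. by split=> [g []|I F _ _]; exists set0; split => // g []. Qed.

Lemma pairing_vanishes phi (I : finType) (c : I -> R[i]) (v : I -> G -> R[i]) (e : R) :
  vanishes_at_infinity phi -> (forall i, character (v i)) -> 0 < e ->
  exists2 Om, dual_compact Om & forall g, character g -> ~ Om g ->
    cabs (pairing c (fun i => dual_add (v i) g) phi) <= e.
Proof.
move=> van cv e0; set A := \sum_i cabs (c i).
have A0 : 0 <= A by apply: sumr_ge0 => i _; exact: cabs_ge0.
have [|K cK Kphi] := van (e / (A + 1)); first by rewrite divr_gt0//; lra.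
exists (\bigcup_(i in [set: I]) dual_shift K (dual_opp (v i))).
  apply: dual_compact_bigcup => // i _; apply: dual_compact_shift => //.
  exact: character_conj.
move=> g cg nOm; apply: le_trans (cabs_sum _) _.
apply: (@le_trans _ _ (A * (e / (A + 1)))).
  rewrite /A mulr_suml; apply: ler_sum => i _; rewrite cabsM ler_wpM2l ?cabs_ge0//.
  apply/ltW/Kphi; first exact: character_mul.
  move=> Kvg; apply: nOm; exists i => //; exists (dual_add (v i) g); split => //.
  apply/funext => x; rewrite /dual_add /dual_opp mulrAC character_mulN//.
  by rewrite mul1r.
rewrite mulrA ler_pdivrMr; last lra.
by rewrite mulrC ler_wpM2l//; lra.
Qed.

(** The integer part of [a], capped at [m] to be a legal ordinal for every real; on [0, m] the cap
    has no effect. *)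
Definition cell (m : nat) (a : R) : 'I_m.+1 := inord (minn m (Num.truncn a)).

Lemma cell_inj (m : nat) (a b : R) : 0 <= a <= m%:R -> 0 <= b <= m%:R ->
  cell m a = cell m b -> `|a - b| < 1.
Proof.
move=> /andP[a0 am] /andP[b0 bm] /(congr1 val); rewrite /= !inordK ?ltnS ?geq_minl//.
have tm (r : R) : 0 <= r -> r <= m%:R -> (Num.truncn r <= m)%N.
  by move=> r0 rm; rewrite -(ler_nat R) (le_trans _ rm)// Num.Theory.truncn_le.
rewrite !(minn_idPr _) ?tm// => h.
have /andP[a1 a2] := Num.Theory.truncn_itv a0; have /andP[b1 b2] := Num.Theory.truncn_itv b0.
move: a1 a2 b1 b2; rewrite h -natr1 ltr_norml => *; apply/andP; split; lra.
Qed.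

(* The restrictions to K of the unit ball of span A form a totally bounded set
   (Bernstein's inequality makes it equicontinuous), so finitely many trigonometric
   polynomials control all of them. *)
Lemma pairing_uniformly_vanishes (A : set (G -> R[i])) phi (eps : R) :
  A `<=` @dual R G -> equicontinuous0 A -> tight_functional phi ->
  vanishes_at_infinity phi -> 0 < eps ->
  exists2 Om, dual_compact Om & forall g, character g -> ~ Om g ->
  forall (I : finType) (c : I -> R[i]) (v : I -> G -> R[i]),
  (forall i, A (v i)) -> (forall x, cabs (trig c v x) <= 1) ->
  cabs (pairing c (fun i => dual_add (v i) g) phi) <= eps.
Proof.
move=> Ac eA [M M0 tM] van eps0.
have [K cK hK] := tM (eps / 8) ltac:(lra).
pose eta := eps / (4 * (M + 1)).
have eta0 : 0 < eta by rewrite divr_gt0// mulr_gt0//; lra.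
have Meta : M * eta <= eps / 4.
  have : eta * (4 * (M + 1)) = eps by rewrite divfK// gt_eqF// mulr_gt0//; lra.
  by lra.
have [e1 e10 he1] := @trig_equicontinuous R G (eta / 4) ltac:(lra).
have [U U0 hU] := eA e1 e10.
have [s hs] := compact_cover_translates cK U0.
(* The grid has mesh 1/N < eta/4. Real and imaginary parts lie in [-1, 1], so after shifting and
   scaling they fill [0, 2N], whence m = 2N. *)
pose N := Num.bound (4 / eta).
have hN : 4 / eta < N%:R by apply: archi_boundP; rewrite divr_ge0//; lra.
have N0 : 0 < (N%:R : R) by apply: le_lt_trans hN; rewrite divr_ge0//; lra.
pose m := (2 * N)%N.
pose pattern (q : G -> R[i]) : {ffun 'I_(size s) -> 'I_m.+1 * 'I_m.+1} :=
  [ffun k : 'I_(size s) => (cell m ((complex.Re (q (nth 0 s k)) + 1) * N%:R),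
     cell m ((complex.Im (q (nth 0 s k)) + 1) * N%:R))].
pose ball (I : finType) (c : I -> R[i]) (v : I -> G -> R[i]) :=
  (forall i, A (v i)) /\ (forall x, cabs (trig c v x) <= 1).
have close (I J : finType) (c : I -> R[i]) (v : I -> G -> R[i])
    (d : J -> R[i]) (w : J -> G -> R[i]) : ball I c v -> ball J d w ->
    pattern (trig c v) = pattern (trig d w) ->
    forall x, K x -> cabs (trig c v x - trig d w x) <= eta.
  move=> [Av cv] [Aw dw] pq x Kx; have [y ys Uxy] := hs x Kx.
  have h1 : cabs (trig c v (y + (x - y)) - trig c v y) <= eta / 4.
    by apply: he1 => // i; [exact: Ac|exact: hU].
  have h2 : cabs (trig d w (y + (x - y)) - trig d w y) <= eta / 4.
    by apply: he1 => // i; [exact: Ac|exact: hU].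
  have range (z : R) : `|z| <= 1 -> 0 <= (z + 1) * N%:R <= m%:R.
    rewrite ler_norml /m natrM => /andP[z1 z2]; apply/andP; split.
      by rewrite mulr_ge0//; lra.
    by rewrite ler_wpM2r//; lra.
  have N4 : 1 <= eta / 4 * N%:R.
    by move: hN; rewrite ltr_pdivrMr// => ?; lra.
  have small (z t : R) : `|z| <= 1 -> `|t| <= 1 ->
      cell m ((z + 1) * N%:R) = cell m ((t + 1) * N%:R) -> `|z - t| <= eta / 4.
    move=> z1 t1 /cell_inj => /(_ (range _ z1) (range _ t1)).
    rewrite -mulrBl opprD addrACA subrr addr0 normrM (ger0_norm (ltW N0)) => h.
    by rewrite -(ler_pM2r N0); lra.
  have h3 : cabs (trig c v y - trig d w y) <= eta / 2.
    have k_lt : (index y s < size s)%N by rewrite index_mem.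
    have := congr1 (fun f : {ffun _ -> _} => f (Ordinal k_lt)) pq.
    rewrite !ffunE /= nth_index// => -[hre him].
    apply: le_trans (ler_cabs_ReIm _) _; rewrite ReD ReN ImD ImN.
    have b1 : `|complex.Re (trig c v y)| <= 1 by apply: le_trans (ler_Re_cabs _) (cv y).
    have b2 : `|complex.Re (trig d w y)| <= 1 by apply: le_trans (ler_Re_cabs _) (dw y).
    have b3 : `|complex.Im (trig c v y)| <= 1 by apply: le_trans (ler_Im_cabs _) (cv y).
    have b4 : `|complex.Im (trig d w y)| <= 1 by apply: le_trans (ler_Im_cabs _) (dw y).
    by have := small _ _ b1 b2 hre; have := small _ _ b3 b4 him; lra.
  have yx : y + (x - y) = x by rewrite addrC subrK.
  rewrite yx in h1 h2.
  apply: le_trans (cabs_dist _ (trig c v y) _) _.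
  apply: le_trans (lerD h1 (cabs_dist _ (trig d w y) _)) _.
  by rewrite (cabsBC (trig d w y) (trig d w x)); lra.
(* One representative serves a whole pattern: replacing a polynomial by it costs at most M eta + 2
   eps/8 <= eps/2, and its own pairing is at most eps/4 off [Om]. A pattern that the ball does not
   realise gets the empty set. *)
pose good (t : {ffun 'I_(size s) -> 'I_m.+1 * 'I_m.+1}) (Om : set (G -> R[i])) :=
  dual_compact Om /\ forall g, character g -> ~ Om g ->
    forall (I : finType) (c : I -> R[i]) (v : I -> G -> R[i]),
    ball I c v -> pattern (trig c v) = t ->
    cabs (pairing c (fun i => dual_add (v i) g) phi) <= eps.
have /(@choice _ _ good)[Om hOm] : forall t, exists Om, good t Om.
  move=> t.
  have [[J [d [w [bw pw]]]]|none] := pselect (exists (J : finType) (d : J -> R[i])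
      (w : J -> G -> R[i]), ball J d w /\ pattern (trig d w) = t); last first.
    exists set0; split; first exact: dual_compact0.
    by move=> g _ _ I c v bv pv; exfalso; apply: none; exists I, c, v.
  have cw j : character (w j) by apply: Ac; exact: bw.1.
  have [Om cOm hOm] := @pairing_vanishes phi J d w (eps / 4) van cw ltac:(lra).
  exists Om; split => // g cg nOm I c v bv pv.
  have cv i : character (v i) by apply: Ac; exact: bv.1.
  have := hOm g cg nOm; set q := pairing d _ phi => hq.
  set p := pairing c _ phi.
  have -> : p = (p - q) + q by rewrite subrK.
  apply: le_trans (cabsD _ _) _.
  have : cabs (p - q) <= M * eta + eps / 8 * 2.
    rewrite /p /q -pairing_sub; apply: hK; [|exact: ltW| |].
    - by move=> [i|j]; exact: character_mul.
    - move=> x; rewrite trig_sub; apply: le_trans (cabsB _ _) _.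
      by rewrite !cabs_trig_mul_character//; have := bv.2 x; have := bw.2 x; lra.
    - move=> x Kx; rewrite trig_sub !trig_mul_character -mulrBl cabsM (cabs_character cg) mulr1.
      by apply: close => //; rewrite pv pw.
  by lra.
exists (\bigcup_(t in [set: {ffun 'I_(size s) -> 'I_m.+1 * 'I_m.+1}]) Om t).
  by apply: dual_compact_bigcup => // t _; exact: (hOm t).1.
move=> g cg nOm I c v Av pv; apply: ((hOm (pattern (trig c v))).2 g) => // Omg.
by apply: nOm; exists (pattern (trig c v)).
Qed.

(** * Local norms on translates of the closure of V *)

Section SpanNorm.
Variable V : set (G -> R[i]).

Lemma normVg_le phi g (e : R) :
  (forall n (c : 'I_n -> R[i]) (h : 'I_n -> G -> R[i]), injective h ->
    (forall i, dual_shift (dual_closure V) g (h i)) ->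
    (forall x, cabs (trig c h x) <= 1) -> cabs (pairing c h phi) <= e) ->
  (normVg V phi g <= e%:E)%E.
Proof.
move=> H; apply: ub_ereal_sup => _ [n [c [h [ih hS hx ->]]]].
by rewrite lee_fin; exact: H.
Qed.

Lemma normVg_ge phi g (e B : R) n (c : 'I_n -> R[i]) (h : 'I_n -> G -> R[i]) :
  (normVg V phi g <= e%:E)%E -> injective h ->
  (forall i, dual_shift (dual_closure V) g (h i)) ->
  0 < B -> (forall x, cabs (trig c h x) <= B) -> cabs (pairing c h phi) <= e * B.
Proof.
move=> He ih hS B0 pB.
have cB : cabs ((B^-1)%:C%C : R[i]) = B^-1 by rewrite cabs_real ger0_norm// invr_ge0 ltW.
have : ((cabs (pairing (fun i => (B^-1)%:C%C * c i) h phi))%:E <= e%:E)%E.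
  apply: le_trans He; apply: ereal_sup_ubound; exists n, (fun i => (B^-1)%:C%C * c i), h.
  split => // x; under eq_bigr do rewrite -mulrA.
  by rewrite -mulr_sumr cabsM cB mulrC ler_pdivrMr// mul1r; exact: pB.
rewrite lee_fin /pairing; under eq_bigr do rewrite -mulrA.
by rewrite -mulr_sumr cabsM cB mulrC ler_pdivrMr.
Qed.

Lemma normVg_vanishes phi (eps : R) :
  locally_compact [set: G] -> dual_compact (dual_closure V) ->
  tight_functional phi -> vanishes_at_infinity phi -> 0 < eps ->
  exists2 Om, dual_compact Om & forall g, character g -> ~ Om g ->
    (normVg V phi g <= eps%:E)%E.
Proof.
move=> lcG cV tphi vphi eps0.
have [Om cOm hOm] := pairing_uniformly_vanishes cV.1
  (dual_compact_equicontinuous0 lcG cV) tphi vphi eps0.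
exists Om => // g cg nOm; apply: normVg_le => n c h ih hS hx.
have [v hv] := choice hS.
have eh : h = fun i => dual_add (v i) g by apply/funext => i; exact: (hv i).2.
rewrite eh; apply: hOm => // [i|x]; first exact: (hv i).1.
by rewrite -(cabs_trig_mul_character _ _ _ cg) -eh.
Qed.

End SpanNorm.
End TightFunctional.

(** * Complex-valued integration *)

Section ComplexIntegral.
Context {d : measure_display} {T : measurableType d} {R : realType}.
Variable mu : {measure set T -> \bar R}.
Implicit Types (A B : set T) (f g : T -> R[i]) (c : R[i]).

Definition cintegrable A f :=
  mu.-integrable A (fun x => (complex.Re (f x))%:E) /\
  mu.-integrable A (fun x => (complex.Im (f x))%:E).

Definition cint_on A f : R[i] :=
  Complex (Rintegral mu A (fun x => complex.Re (f x)))
          (Rintegral mu A (fun x => complex.Im (f x))).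

Lemma eq_cint_on A f g : (forall x, A x -> f x = g x) -> cint_on A f = cint_on A g.
Proof.
by move=> fg; congr Complex; apply: eq_Rintegral => x /set_mem Ax; rewrite fg.
Qed.

Lemma cint_on_set0 f : cint_on set0 f = 0.
Proof. by rewrite /cint_on !Rintegral_set0. Qed.

Section MeasurableSet.
Variable A : set T.
Hypothesis mA : measurable A.

Lemma cintegrable_eq f g : f =1 g -> cintegrable A f -> cintegrable A g.
Proof. by move=> /funext ->. Qed.

Lemma cintegrable0 : cintegrable A (fun=> 0).
Proof. by split; exact: integrable0. Qed.

Lemma cintegrableD f g : cintegrable A f -> cintegrable A g ->
  cintegrable A (fun x => f x + g x).
Proof.
move=> [f1 f2] [g1 g2]; split.
- under eq_fun do rewrite ReD EFinD; exact: integrableD.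
- under eq_fun do rewrite ImD EFinD; exact: integrableD.
Qed.

Lemma cintegrableZ c f : cintegrable A f -> cintegrable A (fun x => c * f x).
Proof.
move=> [f1 f2]; split.
- under eq_fun do rewrite ReM.
  exact: (integrableB mA (integrableZl mA (complex.Re c) f1) (integrableZl mA (complex.Im c) f2)).
- under eq_fun do rewrite ImM.
  exact: (integrableD mA (integrableZl mA (complex.Re c) f2) (integrableZl mA (complex.Im c) f1)).
Qed.

Lemma cint_onD f g : cintegrable A f -> cintegrable A g ->
  cint_on A (fun x => f x + g x) = cint_on A f + cint_on A g.
Proof.
move=> [f1 f2] [g1 g2]; apply/eqP; rewrite eq_complex ReD ImD /=; apply/andP; split; apply/eqP.
- by under eq_Rintegral do rewrite ReD; rewrite RintegralD.
- by under eq_Rintegral do rewrite ImD; rewrite RintegralD.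
Qed.

Lemma cint_onZ c f : cintegrable A f -> cint_on A (fun x => c * f x) = c * cint_on A f.
Proof.
move=> [f1 f2]; apply/eqP; rewrite eq_complex ReM ImM /=; apply/andP; split; apply/eqP.
- under eq_Rintegral do rewrite ReM.
  rewrite RintegralB//; first by rewrite !RintegralZl.
  + exact: (integrableZl mA (complex.Re c) f1).
  + exact: (integrableZl mA (complex.Im c) f2).
- under eq_Rintegral do rewrite ImM.
  rewrite RintegralD//; first by rewrite !RintegralZl.
  + exact: (integrableZl mA (complex.Re c) f2).
  + exact: (integrableZl mA (complex.Im c) f1).
Qed.

Lemma cintegrable_sum (I : finType) (f : I -> T -> R[i]) :
  (forall i, cintegrable A (f i)) -> cintegrable A (fun x => \sum_i f i x).
Proof.
move=> cf; elim: (index_enum I) => [|i s IH].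
  by apply: cintegrable_eq cintegrable0 => x; rewrite big_nil.
by apply: cintegrable_eq (cintegrableD (cf i) IH) => x; rewrite big_cons.
Qed.

Lemma cint_on_sum (I : finType) (f : I -> T -> R[i]) : (forall i, cintegrable A (f i)) ->
  cint_on A (fun x => \sum_i f i x) = \sum_i cint_on A (f i).
Proof.
move=> cf.
suff [_ ->] : cintegrable A (fun x => \sum_i f i x) /\
  cint_on A (fun x => \sum_i f i x) = \sum_i cint_on A (f i) by [].
elim: (index_enum I) => [|i s [IH1 IH2]].
  split; first by apply: cintegrable_eq cintegrable0 => x; rewrite big_nil.
  rewrite big_nil; under [LHS]eq_cint_on do rewrite big_nil.
  by rewrite /cint_on /= !Rintegral_cst// !mul0r.
have e : (fun x => \sum_(j <- i :: s) f j x) = (fun x => f i x + \sum_(j <- s) f j x).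
  by apply/funext => x; rewrite big_cons.
by rewrite e; split; [exact: cintegrableD|rewrite cint_onD// IH2 big_cons].
Qed.

(** Real and imaginary parts are estimated separately. This is the origin of the factors 2 in the
    later bounds. *)
Lemma cabs_cint_on_le f (h : T -> R) : cintegrable A f ->
  mu.-integrable A (EFin \o h) -> (forall x, A x -> cabs (f x) <= h x) ->
  cabs (cint_on A f) <= 2 * Rintegral mu A h.
Proof.
move=> [f1 f2] ih fh; apply: le_trans (ler_cabs_ReIm _) _ => /=.
have key (u : T -> R) : mu.-integrable A (EFin \o u) -> (forall x, A x -> `|u x| <= h x) ->
    `|Rintegral mu A u| <= Rintegral mu A h.
  move=> iu uh; apply: le_trans (le_normr_Rintegral mA iu) _.
  apply: le_Rintegral => //.
  by have := integrable_abse iu; congr (integrable _ _ _); apply/funext.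
rewrite mulr2n mulrDl mul1r; apply: lerD; apply: key => // x Ax.
- exact: le_trans (ler_Re_cabs _) (fh x Ax).
- exact: le_trans (ler_Im_cabs _) (fh x Ax).
Qed.

Lemma cabs_cint_on_bound f (B : R) : (mu A < +oo)%E -> cintegrable A f ->
  (forall x, A x -> cabs (f x) <= B) -> cabs (cint_on A f) <= 2 * (B * fine (mu A)).
Proof.
move=> fA cf fB; rewrite -Rintegral_cst//; apply: cabs_cint_on_le => //.
by apply: (measurable_bounded_integrable mA fA) => //; exact: bounded_cst.
Qed.

Lemma cintegrable_bounded f (B : R) : (mu A < +oo)%E ->
  measurable_fun A (fun x => complex.Re (f x)) ->
  measurable_fun A (fun x => complex.Im (f x)) ->
  (forall x, A x -> cabs (f x) <= B) -> cintegrable A f.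
Proof.
move=> fA m1 m2 fB; split; apply: measurable_bounded_integrable => //.
- exists B; split; first exact: num_real.
  by move=> M BM x Ax; apply: le_trans (ltW BM); exact: le_trans (ler_Re_cabs _) (fB x Ax).
- exists B; split; first exact: num_real.
  by move=> M BM x Ax; apply: le_trans (ltW BM); exact: le_trans (ler_Im_cabs _) (fB x Ax).
Qed.

Lemma cint_on_cst c : cint_on A (fun=> c) = (fine (mu A))%:C%C * c.
Proof.
rewrite /cint_on !Rintegral_cst//; case: c => a b.
by apply/eqP; rewrite eq_complex /= !mul0r subr0 addr0 ![fine _ * _]mulrC !eqxx.
Qed.

Lemma cint_on_split B f : measurable B -> cintegrable A f ->
  cint_on A f = cint_on (A `&` B) f + cint_on (A `\` B) f.
Proof.
move=> mB [f1 f2]; have AE : A = (A `&` B) `|` (A `\` B) by rewrite setUIDK.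
have dis : [disjoint A `&` B & A `\` B].
  by rewrite disj_set2E; apply/eqP; rewrite -subset0 => x [[_ ?] []].
have m1 : measurable (A `&` B) by exact: measurableI.
have m2 : measurable (A `\` B) by exact: measurableD.
apply/eqP; rewrite eq_complex ReD ImD /= {1 4}AE; apply/andP; split; apply/eqP.
- by rewrite Rintegral_setU// -AE.
- by rewrite Rintegral_setU// -AE.
Qed.

Lemma cintegrableS B f : measurable B -> B `<=` A -> cintegrable A f -> cintegrable B f.
Proof. by move=> mB BA [f1 f2]; split; exact: integrableS f1 || exact: integrableS f2. Qed.

End MeasurableSet.
End ComplexIntegral.

(** * Fourier transforms of measures *)

Section BorelIntegral.
Context {R : realType} {G : topologicalZmodType}.
Implicit Types (n m : {measure set (Borel G) -> \bar R}) (A E : set (Borel G)).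

Lemma finite_measureS n A E : measurable A -> measurable E -> E `<=` A ->
  (n A < +oo)%E -> (n E < +oo)%E.
Proof. by move=> mA mE EA; apply: le_lt_trans; apply: le_measure => //; exact: mem_set. Qed.

Lemma fine_measureS n A E : measurable A -> measurable E -> E `<=` A ->
  (n A < +oo)%E -> fine (n E) <= fine (n A).
Proof.
move=> mA mE EA fA; have fE := finite_measureS mA mE EA fA.
by apply: fine_le; rewrite ?ge0_fin_numE//; apply: le_measure => //; exact: mem_set.
Qed.

Lemma open_borel (U : set G) : open U -> measurable (U : set (Borel G)).
Proof. by move=> oU; exact: sub_sigma_algebra. Qed.

Lemma closed_borel (K : set G) : closed K -> measurable (K : set (Borel G)).
Proof.
by move=> cK; rewrite -(setCK K); apply: measurableC; apply: open_borel; exact: closed_openC.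
Qed.

Lemma compact_borel (K : set G) :
  hausdorff_space G -> compact K -> measurable (K : set (Borel G)).
Proof. by move=> hG cK; apply: closed_borel; exact: compact_closed. Qed.

Lemma continuous_borel (u : G -> R) : continuous u ->
  measurable_fun [set: Borel G] (u : Borel G -> R).
Proof.
move=> cu; apply: (measurability _ (measurable_realfun.RGenOInfty.measurableE R)).
move=> _ [_ [x ->] <-]; rewrite setTI; apply: open_borel.
by apply: open_comp => [y _|]; [exact: cu|exact: interval_open].
Qed.

Definition cbounded (f : G -> R[i]) :=
  [/\ continuous (fun x => complex.Re (f x)), continuous (fun x => complex.Im (f x)) &
      exists B : R, forall x, cabs (f x) <= B].

Lemma cbounded_cintegrable n A f : measurable A -> (n A < +oo)%E -> cbounded f ->
  cintegrable n A f.
Proof.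
move=> mA fA [c1 c2 [B fB]]; apply: (cintegrable_bounded mA fA _ _ (fun x _ => fB x)).
- by apply: measurable_funTS; exact: continuous_borel.
- by apply: measurable_funTS; exact: continuous_borel.
Qed.

Lemma cboundedZ (c : R[i]) f : cbounded f -> cbounded (fun x => c * f x).
Proof.
move=> [c1 c2 [B fB]]; split.
- move=> x; under eq_fun do rewrite ReM.
  by apply: cvgB; apply: cvgM; [exact: cvg_cst|exact: c1|exact: cvg_cst|exact: c2].
- move=> x; under eq_fun do rewrite ImM.
  by apply: cvgD; apply: cvgM; [exact: cvg_cst|exact: c2|exact: cvg_cst|exact: c1].
- by exists (cabs c * B) => x; rewrite cabsM ler_wpM2l ?cabs_ge0.
Qed.

Lemma cboundedD f g : cbounded f -> cbounded g -> cbounded (fun x => f x + g x).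
Proof.
move=> [c1 c2 [B fB]] [d1 d2 [C gC]]; split.
- by move=> x; under eq_fun do rewrite ReD; apply: cvgD; [exact: c1|exact: d1].
- by move=> x; under eq_fun do rewrite ImD; apply: cvgD; [exact: c2|exact: d2].
- by exists (B + C) => x; rewrite (le_trans (cabsD _ _))// lerD.
Qed.

Lemma cbounded_cst (c : R[i]) : cbounded (fun=> c).
Proof. by split; [move=> x; exact: cvg_cst|move=> x; exact: cvg_cst|exists (cabs c)]. Qed.

Lemma cbounded_character g : character g -> cbounded g.
Proof. by move=> cg; case: (cg) => c1 [c2 _]; split => //; exists 1 => x; rewrite cabs_character. Qed.

Lemma cbounded_sum (I : finType) (f : I -> G -> R[i]) : (forall i, cbounded (f i)) ->
  cbounded (fun x => \sum_i f i x).
Proof.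
move=> cf; elim: (index_enum I) => [|i s IH].
  by under eq_fun do rewrite big_nil; exact: cbounded_cst.
by under eq_fun do rewrite big_cons; exact: cboundedD.
Qed.

(** The set [A] is a parameter so that the same estimates serve finite measures on the whole group
    and Haar measure on sets of finite measure. *)
Definition hat n A (g : G -> R[i]) : R[i] := cint_on n A (fun x => g (- x)).

Lemma cbounded_trig_opp (I : finType) (c : I -> R[i]) (g : I -> G -> R[i]) :
  (forall i, character (g i)) -> cbounded (fun x => trig c g (- x)).
Proof.
move=> cg; apply: cbounded_sum => i; apply: (@cboundedZ (c i) (fun x => g i (- x))).
by apply: cbounded_character; exact: character_conj.
Qed.

Lemma pairing_hat n A (I : finType) (c : I -> R[i]) (g : I -> G -> R[i]) :
  measurable A -> (n A < +oo)%E -> (forall i, character (g i)) ->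
  pairing c g (hat n A) = cint_on n A (fun x => trig c g (- x)).
Proof.
move=> mA fA cg; have cgi i : cintegrable n A (fun x => g i (- x)).
  by apply: cbounded_cintegrable => //; apply: cbounded_character; exact: character_conj.
rewrite /trig cint_on_sum//; last by move=> i; exact: cintegrableZ.
by apply: eq_bigr => i _; rewrite cint_onZ.
Qed.

Definition tight_on n A := [/\ measurable A, (n A < +oo)%E &
  forall e : R, 0 < e -> exists2 K : set G, compact K & (n (A `\` K) <= e%:E)%E].

Lemma tight_functional_hat n A : hausdorff_space G -> tight_on n A ->
  tight_functional (hat n A).
Proof.
move=> hG [mA fA tA]; exists (2 * fine (n A)); first by rewrite mulr_ge0// fine_ge0.
move=> eps e0; have [|K cK nK] := tA (eps / 2); first lra.
(* Polynomials are integrated at - x, so they are tested on the reflection of K. *)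
exists [set - x | x in K]; first exact: compact_opp.
move=> I c g cg B eta eta0 pB pK; rewrite pairing_hat//.
have mK : measurable (K : set (Borel G)) by exact: compact_borel.
have cA : cintegrable n A (fun x => trig c g (- x)).
  by apply: cbounded_cintegrable => //; exact: cbounded_trig_opp.
have m1 : measurable (A `&` K) by exact: measurableI.
have m2 : measurable (A `\` K) by exact: measurableD.
have f1 : (n (A `&` K) < +oo)%E by exact: finite_measureS fA.
have f2 : (n (A `\` K) < +oo)%E by exact: finite_measureS fA.
have B0 : 0 <= B by apply: le_trans (pB 0); exact: cabs_ge0.
rewrite (cint_on_split mA mK cA); apply: le_trans (cabsD _ _) _.
apply: lerD.
- apply: (@le_trans _ _ (2 * (eta * fine (n (A `&` K))))).
    apply: cabs_cint_on_bound => //; first exact: cintegrableS cA.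
    by move=> x [_ Kx]; apply: pK; exists x.
  rewrite -mulrA ler_wpM2l// [leRHS]mulrC ler_wpM2l//.
  exact: fine_measureS.
- apply: (@le_trans _ _ (2 * (B * fine (n (A `\` K))))).
    by apply: cabs_cint_on_bound => //; exact: cintegrableS cA.
  have : fine (n (A `\` K)) <= eps / 2 by rewrite -lee_fin fineK// ge0_fin_numE.
  nra.
Qed.

Lemma tight_functional_add (phi psi : (G -> R[i]) -> R[i]) (b : R[i]) :
  tight_functional phi -> tight_functional psi ->
  tight_functional (fun g => phi g + b * psi g).
Proof.
move=> [M M0 tM] [N N0 tN]; have b0 := cabs_ge0 b.
exists (M + cabs b * N); first by rewrite addr_ge0// mulr_ge0.
move=> eps e0; have [|K cK hK] := tM (eps / 2); first lra.
have [|L cL hL] := tN (eps / 2 / (cabs b + 1)); first by rewrite !divr_gt0//; lra.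
exists (K `|` L); first exact: compactU.
move=> I c g cg B eta eta0 pB pK.
have B0 : 0 <= B by apply: le_trans (pB 0); exact: cabs_ge0.
have -> : pairing c g (fun g => phi g + b * psi g) = pairing c g phi + b * pairing c g psi.
  by rewrite /pairing mulr_sumr -big_split; apply: eq_bigr => i _ /=; ring.
apply: le_trans (cabsD _ _) _; rewrite cabsM.
have h1 := hK I c g cg B eta eta0 pB (fun x Kx => pK x (or_introl Kx)).
have h2 := hL I c g cg B eta eta0 pB (fun x Lx => pK x (or_intror Lx)).
have h3 : cabs b * (eps / 2 / (cabs b + 1)) <= eps / 2.
  by rewrite mulrA ler_pdivrMr; [rewrite mulrC ler_wpM2l//; lra|lra].
move: h1 h2 h3; move: (cabs (pairing _ _ phi)) (cabs (pairing _ _ psi)) (cabs b) (eps / 2 / (_ + _)) b0.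
move=> p q s t s0 h1 /(ler_wpM2l s0) h2 /(ler_wpM2r B0) h3.
lra.
Qed.

End BorelIntegral.

(** * Replacing measures by finitely supported ones *)

Section Discretization.
Context {R : realType} {G : topologicalZmodType}.
Implicit Types (n m : {measure set (Borel G) -> \bar R}) (A E : set (Borel G)).

Lemma fine_measure_split n A E : measurable A -> measurable E -> (n A < +oo)%E ->
  fine (n A) = fine (n (A `&` E)) + fine (n (A `\` E)).
Proof.
move=> mA mE fA; rewrite addrC (measureDI n mA mE) fineD//.
- by rewrite ge0_fin_numE// (finite_measureS mA)//; exact: measurableD.
- by rewrite ge0_fin_numE// (finite_measureS mA)//; exact: measurableI.
Qed.

(** Removing one translate of U at a time turns the cover into a measurable partition, and the
    weights are the masses of its cells. They are chosen before [f], so one discretisation serves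
    all admissible functions. *)
Lemma cint_on_discretize n (U : set G) (delta : R) (s : seq G) : open U -> 0 <= delta ->
  forall A, measurable A -> (n A < +oo)%E ->
  (forall x, A x -> exists2 y, y \in s & U (x - y)) ->
  exists a : 'I_(size s) -> R, [/\ forall k, 0 <= a k, \sum_k a k <= fine (n A) &
    forall f, cbounded f -> (forall x y, U (x - y) -> cabs (f x - f y) <= delta) ->
    cabs (cint_on n A f - \sum_k (a k)%:C%C * f (nth 0 s k)) <= 2 * (delta * fine (n A))].
Proof.
move=> oU delta0; elim: s => [|y s IH] A mA fA As.
  have -> : A = set0 by rewrite -subset0 => x /As[y]; rewrite in_nil.
  exists (fun=> 0); rewrite measure0 !big_ord0; split => // f _ _.
  by rewrite big_ord0 cint_on_set0 subrr cabs0 !mulr0.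
pose B : set (Borel G) := [set x : G | U (x - y)].
have mB : measurable B by apply: open_borel; exact: open_translate.
have m1 : measurable (A `&` B) by exact: measurableI.
have m2 : measurable (A `\` B) by exact: measurableD.
have f1 : (n (A `&` B) < +oo)%E by exact: finite_measureS fA.
have f2 : (n (A `\` B) < +oo)%E by exact: finite_measureS fA.
have [|a [a0 sa ha]] := IH (A `\` B) m2 f2.
  by move=> x [/As[z]]; rewrite inE => /orP[/eqP ->//|zs Uxz _]; exists z.
exists (fun k => if unlift ord0 k is Some j then a j else fine (n (A `&` B))); split.
- by move=> k; case: unliftP => [j _|_]; [exact: a0|exact: fine_ge0].
- rewrite big_ord_recl unlift_none (fine_measure_split mA mB fA) lerD2l.
  by under eq_bigr do rewrite liftK.
move=> f cf Uf; rewrite big_ord_recl unlift_none /=.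
have cA : cintegrable n A f by exact: cbounded_cintegrable.
under eq_bigr do rewrite liftK.
rewrite (cint_on_split mA mB cA) opprD addrACA (fine_measure_split mA mB fA) !mulrDr.
apply: le_trans (cabsD _ _) _; apply: lerD; last exact: ha.
have c1 : cintegrable n (A `&` B) f by exact: cbounded_cintegrable.
have c2 : cintegrable n (A `&` B) (fun=> - f y).
  by apply: cbounded_cintegrable => //; exact: cbounded_cst.
rewrite -mulrN -cint_on_cst// -cint_onD//; apply: cabs_cint_on_bound => //.
  exact: cintegrableD.
by move=> x [_ Bx]; exact: Uf.
Qed.

(* On trigonometric polynomials with a given modulus of continuity, phi acts like a
   finitely supported measure whose mass is bounded independently of that modulus. *)
Definition discretizable (phi : (G -> R[i]) -> R[i]) := exists2 M : R, 0 <= M &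
  forall (delta : R) (W : set G), 0 < delta -> nbhs 0 W ->
  exists (J : finType) (a : J -> R[i]) (x : J -> G), \sum_j cabs (a j) <= M /\
  forall (I : finType) (c : I -> R[i]) (g : I -> G -> R[i]), (forall i, character (g i)) ->
  (forall x, cabs (trig c g x) <= 1) ->
  (forall x y, W y -> cabs (trig c g (x + y) - trig c g x) <= delta) ->
  cabs (pairing c g phi - \sum_j a j * trig c g (- x j)) <= M * delta.

Lemma discretizable_hat n A : hausdorff_space G -> tight_on n A -> discretizable (hat n A).
Proof.
move=> hG [mA fA tA]; exists (2 * fine (n A) + 2).
  by rewrite addr_ge0// mulr_ge0// fine_ge0.
move=> delta W d0 W0; have [K cK nK] := tA delta d0.
(* Polynomials are evaluated at - x, so x - y in [U] has to put - x within [W] of - y. Taking the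
   interior makes the cells Borel. *)
pose U := interior [set w | W (- w)].
have oU : open U by exact: open_interior.
have U0 : nbhs 0 U by apply: nbhs_interior; exact: nbhs0_opp.
have mK : measurable (K : set (Borel G)) by exact: compact_borel.
have m1 : measurable (A `&` K) by exact: measurableI.
have m2 : measurable (A `\` K) by exact: measurableD.
have f1 : (n (A `&` K) < +oo)%E by exact: finite_measureS fA.
have f2 : (n (A `\` K) < +oo)%E by exact: finite_measureS fA.
have [s hs] := compact_cover_translates cK U0.
have [|a [a0 sa ha]] := cint_on_discretize oU (ltW d0) m1 f1 (s := s).
  by move=> x [_ /hs].
have nA0 : 0 <= fine (n A) by exact: fine_ge0.
have le1 : fine (n (A `&` K)) <= fine (n A) by exact: fine_measureS fA.
exists ('I_(size s) : finType), (fun k => (a k)%:C%C), (fun k : 'I_(size s) => nth 0 s k); split.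
  under eq_bigr do rewrite cabs_real ger0_norm//.
  by lra.
move=> I c g cg p1 pW; rewrite pairing_hat//.
have cf : cbounded (fun x => trig c g (- x)) by exact: cbounded_trig_opp.
have cA := cbounded_cintegrable mA fA cf.
rewrite (cint_on_split mA mK cA) addrAC; apply: le_trans (cabsD _ _) _.
rewrite mulrDl; apply: lerD.
  apply: le_trans (ha _ cf _) _.
    move=> x y /interior_subset Wxy; have -> : - x = - y + - (x - y).
      by rewrite opprB addKr.
    exact: pW.
  by rewrite -mulrA ler_wpM2l// mulrC ler_wpM2r// ltW.
apply: le_trans (cabs_cint_on_bound (B := 1) m2 f2 _ _) _ => //.
  exact: cintegrableS cA.
by rewrite mul1r ler_wpM2l// -lee_fin fineK// ge0_fin_numE.
Qed.

Lemma discretizable_add (phi psi : (G -> R[i]) -> R[i]) (b : R[i]) :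
  discretizable phi -> discretizable psi -> discretizable (fun g => phi g + b * psi g).
Proof.
move=> [M M0 tM] [N N0 tN]; have b0 := cabs_ge0 b.
exists (M + cabs b * N); first by rewrite addr_ge0// mulr_ge0.
move=> delta W d0 W0; have [J [a [x [sa ha]]]] := tM delta W d0 W0.
have [L [e [y [se he]]]] := tN delta W d0 W0.
exists (J + L)%type, (sum_family a (fun l => b * e l)), (sum_family x y); split.
  rewrite big_sumType /= lerD//; under eq_bigr do rewrite cabsM.
  by rewrite -mulr_sumr ler_wpM2l.
move=> I c g cg p1 pW; rewrite big_sum_type /=.
have -> : pairing c g (fun g => phi g + b * psi g) = pairing c g phi + b * pairing c g psi.
  by rewrite /pairing mulr_sumr -big_split; apply: eq_bigr => i _ /=; ring.
under [X in _ - (_ + X)]eq_bigr do rewrite -mulrA.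
rewrite -mulr_sumr opprD addrACA -mulrBr mulrDl.
apply: le_trans (cabsD _ _) _; rewrite cabsM -mulrA; apply: lerD; first exact: ha.
by rewrite ler_wpM2l//; exact: he.
Qed.

End Discretization.

(** * Haar measure and the Riemann-Lebesgue lemma *)

Section Vanishing.
Context {R : realType} {G : topologicalZmodType}.
Implicit Types (phi psi : (G -> R[i]) -> R[i]).

Lemma vanishes_add phi psi (b : R[i]) : vanishes_at_infinity phi -> vanishes_at_infinity psi ->
  vanishes_at_infinity (fun g => phi g + b * psi g).
Proof.
move=> v1 v2 e e0; have b0 := cabs_ge0 b.
have [|K cK hK] := v1 (e / 2); first lra.
have [|L cL hL] := v2 (e / 2 / (cabs b + 1)); first by rewrite !divr_gt0//; lra.
exists (K `|` L); first exact: dual_compactU.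
move=> g cg nKL; apply: le_lt_trans (cabsD _ _) _; rewrite cabsM.
have := hK g cg (fun Kg => nKL (or_introl Kg)).
have := hL g cg (fun Lg => nKL (or_intror Lg)).
rewrite ltr_pdivlMr; last lra.
have := cabs_ge0 (psi g); move: (cabs (psi g)) (cabs (phi g)) (cabs b) b0 => p q s; nra.
Qed.

Lemma vanishes_approx phi :
  (forall e : R, 0 < e -> exists2 psi, vanishes_at_infinity psi &
     forall g, character g -> cabs (phi g - psi g) <= e) -> vanishes_at_infinity phi.
Proof.
move=> H e e0; have [|psi vpsi hpsi] := H (e / 2); first lra.
have [|K cK hK] := vpsi (e / 2); first lra.
exists K => // g cg nKg; rewrite -[phi g](subrK (psi g)).
by apply: le_lt_trans (cabsD _ _) _; have := hpsi g cg; have := hK g cg nKg; lra.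
Qed.

Lemma vanishes0 : vanishes_at_infinity (fun _ : G -> R[i] => 0 : R[i]).
Proof. by move=> e e0; exists set0; [exact: dual_compact0|move=> g _ _; rewrite cabs0]. Qed.

Lemma vanishes_sum (J : finType) (b : J -> R[i]) (phi : J -> (G -> R[i]) -> R[i]) :
  (forall j, vanishes_at_infinity (phi j)) ->
  vanishes_at_infinity (fun g => \sum_j b j * phi j g).
Proof.
move=> vphi; elim: (index_enum J) => [|j s IH].
  by under eq_fun do rewrite big_nil; exact: vanishes0.
by under eq_fun do rewrite big_cons addrC; exact: vanishes_add.
Qed.

End Vanishing.

Section IndicatorIntegral.
Context {d : measure_display} {T : measurableType d} {R : realType}.
Variable mu : {measure set T -> \bar R}.

Definition cindic (E : set T) (x : T) : R[i] := (\1_E x : R)%:C%C.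

Lemma Re_cindicM E (f : T -> R[i]) :
  (fun x => complex.Re (cindic E x * f x)) = (fun x => complex.Re (f x)) \_ E.
Proof.
apply/funext => x; rewrite ReM /= mul0r subr0 patchE indicE.
by case: (x \in E); rewrite ?mul1r ?mul0r.
Qed.

Lemma Im_cindicM E (f : T -> R[i]) :
  (fun x => complex.Im (cindic E x * f x)) = (fun x => complex.Im (f x)) \_ E.
Proof.
apply/funext => x; rewrite ImM /= mul0r addr0 patchE indicE.
by case: (x \in E); rewrite ?mul1r ?mul0r.
Qed.

Lemma cintegrable_indic E (f : T -> R[i]) : measurable E -> cintegrable mu E f ->
  cintegrable mu setT (fun x => cindic E x * f x).
Proof.
move=> mE [f1 f2]; split.
- rewrite (_ : (fun x => _) = (EFin \o (fun x => complex.Re (f x))) \_ E).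
    exact: (integrable_mkcond _ mE).1.
  by rewrite restrict_EFin -Re_cindicM.
- rewrite (_ : (fun x => _) = (EFin \o (fun x => complex.Im (f x))) \_ E).
    exact: (integrable_mkcond _ mE).1.
  by rewrite restrict_EFin -Im_cindicM.
Qed.

Lemma cint_on_indic E (f : T -> R[i]) :
  cint_on mu setT (fun x => cindic E x * f x) = cint_on mu E f.
Proof.
rewrite /cint_on [in RHS]Rintegral_mkcond -Re_cindicM; congr Complex.
by rewrite [in RHS]Rintegral_mkcond -Im_cindicM.
Qed.

Lemma cintegrable_mul_bounded (f u : T -> R[i]) : cintegrable mu setT f ->
  measurable_fun setT (fun x => complex.Re (u x)) ->
  measurable_fun setT (fun x => complex.Im (u x)) ->
  (forall x, cabs (u x) <= 1) -> cintegrable mu setT (fun x => f x * u x).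
Proof.
move=> [f1 f2] u1 u2 ub.
have mf1 : measurable_fun setT (fun x => complex.Re (f x)).
  by apply/measurable_EFinP; exact: measurable_int f1.
have mf2 : measurable_fun setT (fun x => complex.Im (f x)).
  by apply/measurable_EFinP; exact: measurable_int f2.
have dom := integrableD measurableT (integrable_abse f1) (integrable_abse f2).
have b1 x : `|complex.Re (u x)| <= 1 by apply: le_trans (ler_Re_cabs _) (ub x).
have b2 x : `|complex.Im (u x)| <= 1 by apply: le_trans (ler_Im_cabs _) (ub x).
have sum_le (a b s t : R) : `|s| <= 1 -> `|t| <= 1 -> `|a * s + b * t| <= `|a| + `|b|.
  move=> s1 t1; apply: le_trans (ler_normD _ _) _; rewrite !normrM.
  by apply: lerD; rewrite ler_piMr.
split; apply: (le_integrable measurableT _ _ dom).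
- by apply/measurable_EFinP; under eq_fun do rewrite ReM;
  apply: measurable_funB; apply: measurable_funM.
- move=> x _; rewrite ReM /= lee_fin (ger0_norm (addr_ge0 (normr_ge0 _) (normr_ge0 _))).
  by rewrite -mulrN; apply: sum_le; rewrite ?normrN.
- by apply/measurable_EFinP; under eq_fun do rewrite ImM;
  apply: measurable_funD; apply: measurable_funM.
- move=> x _; rewrite ImM /= lee_fin (ger0_norm (addr_ge0 (normr_ge0 _) (normr_ge0 _))).
  by apply: sum_le.
Qed.

End IndicatorIntegral.

Section Haar.
Context {R : realType} {G : topologicalZmodType}.
Variable m : {measure set (Borel G) -> \bar R}.
Hypotheses (hausG : hausdorff_space G) (haarm : haar m).
Implicit Types (A E : set (Borel G)) (x : G).

Lemma measurable_translation x :
  measurable_fun [set: Borel G] (fun y : Borel G => (x + y : Borel G)).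
Proof.
apply: (measurability _ (erefl : @measurable _ (Borel G) = <<s @open G >>)).
move=> _ [U oU <-]; rewrite setTI; apply: open_borel.
by rewrite (_ : _ @^-1` U = [set z : G | U (z - - x)]); [exact: open_translate|
  apply/seteqP; split => z /=; rewrite opprK addrC].
Qed.

Lemma translate_preimage x A : [set x + y | y in A] = (fun y : G => - x + y) @^-1` A.
Proof.
apply/seteqP; split => [_ [y Ay <-]|z Az] /=; first by rewrite addKr.
by exists (- x + z) => //; rewrite addNKr.
Qed.

Lemma measurable_translate x A : measurable A -> measurable ([set x + y | y in A] : set (Borel G)).
Proof.
move=> mA; rewrite translate_preimage -[X in measurable X]setTI.
exact: measurable_translation.
Qed.

Lemma haar_translate x A : measurable A -> m [set x + y | y in A] = m A.
Proof. by case: haarm => _ _ _ h _; exact: h. Qed.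

(** By invariance m equals its own image under translation, so this is the change of variables
    formula for image measures. *)
Lemma Rintegral_translate x A (u : G -> R) : measurable A -> continuous u ->
  m.-integrable A (EFin \o (fun y : Borel G => u (x + y))) ->
  Rintegral m [set x + y | y in A] (u : Borel G -> R) =
  Rintegral m A (fun y => u (x + y)).
Proof.
move=> mA cu iu; congr fine.
pose phi := fun y : Borel G => (x + y : Borel G).
have mphi : measurable_fun setT phi by exact: measurable_translation.
have preA : phi @^-1` [set x + y | y in A] = A.
  by rewrite translate_preimage; apply/seteqP; split => y /=; rewrite addKr.
rewrite (eq_measure_integral (pushforward m phi)).
  rewrite integral_pushforward ?preA//.
  - by apply/measurable_EFinP; exact: continuous_borel.
  - exact: measurable_translate.
move=> E mE _; rewrite -(haar_translate (- x) mE) /pushforward translate_preimage opprK.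
by [].
Qed.

Lemma cint_on_translate x A f : measurable A -> (m A < +oo)%E -> cbounded f ->
  cint_on m [set x + y | y in A] f = cint_on m A (fun y => f (x + y)).
Proof.
move=> mA fA cf; have [c1 c2 [B fB]] := cf.
have ct : continuous (fun y : G => x + y).
  move=> z; apply: (@continuous_comp _ _ _ (fun z : G => (x, z)) (fun z : G * G => z.1 + z.2)).
    by apply: cvg_pair; [exact: cvg_cst|exact: cvg_id].
  exact: add_continuous.
have [i1 i2] : cintegrable m A (fun y : Borel G => f (x + y)).
  apply: cbounded_cintegrable => //; split; last by exists B.
  - move=> z; apply: (@continuous_comp _ _ _ (fun z => x + z) (fun w => complex.Re (f w)) z).
      exact: ct.
    exact: c1.
  - move=> z; apply: (@continuous_comp _ _ _ (fun z => x + z) (fun w => complex.Im (f w)) z).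
      exact: ct.
    exact: c2.
by congr Complex; apply: Rintegral_translate.
Qed.

Lemma hat_translate x A g : measurable A -> (m A < +oo)%E -> character g ->
  hat m [set x + y | y in A] g = g (- x) * hat m A g.
Proof.
move=> mA fA cg; have cg' := cbounded_character (character_conj cg).
rewrite /hat cint_on_translate// -cint_onZ//; last exact: cbounded_cintegrable.
by apply: eq_cint_on => y _; rewrite opprD characterD.
Qed.

Lemma hat_subset A E g (e : R) : measurable A -> measurable E -> E `<=` A -> (m A < +oo)%E ->
  (m A <= m E + e%:E)%E -> character g -> cabs (hat m A g - hat m E g) <= 2 * e.
Proof.
move=> mA mE EA fA le_e cg; have cg' := cbounded_character (character_conj cg).
have cA := cbounded_cintegrable mA fA cg'.
have mD : measurable (A `\` E) by exact: measurableD.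
rewrite /hat (cint_on_split mA mE cA) (setIidr EA) addrC addrA addNr add0r.
apply: le_trans (cabs_cint_on_bound (B := 1) mD _ _ _) _.
- exact: finite_measureS fA.
- exact: cintegrableS cA.
- by move=> y _; rewrite cabs_character.
have fE := finite_measureS mA mE EA fA.
rewrite mul1r ler_wpM2l// -(lerD2l (fine (m E))).
have := fine_measure_split mA mE fA; rewrite (setIidr EA) => <-.
by rewrite -lee_fin EFinD !fineK// ge0_fin_numE.
Qed.

Lemma haar_outer A (e : R) : measurable A -> (m A < +oo)%E -> 0 < e ->
  exists U : set G, [/\ open U, A `<=` U, (m U < +oo)%E & (m U <= m A + e%:E)%E].
Proof.
move=> mA fA e0; have fA' : m A \is a fin_num by rewrite ge0_fin_numE.
have lt_e : (m A < m A + e%:E)%E by rewrite lteDl// lte_fin.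
case: (haarm) => _ /(_ A mA) outer _ _ _.
move: lt_e; rewrite [X in (X < _)%E]outer => /ereal_inf_lt[_ [U [oU AU] <-] UA].
exists U; split => //; last exact: ltW.
by apply: lt_trans UA _; rewrite -ge0_fin_numE ?fin_numD ?fA'// adde_ge0// lee_fin ltW.
Qed.

Lemma haar_inner (U : set G) (e : R) : open U -> (m U < +oo)%E -> 0 < e ->
  exists K : set G, [/\ compact K, K `<=` U & (m U <= m K + e%:E)%E].
Proof.
move=> oU fU e0; have fU' : m U \is a fin_num by rewrite ge0_fin_numE.
case: (haarm) => _ _ /(_ U oU) inner _ _.
have : (m U - e%:E < m U)%E by rewrite lteBlDr// lteDl// lte_fin.
rewrite [X in (_ < X)%E]inner => /ereal_sup_gt[_ [K [cK KU] <-] UK].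
by exists K; split => //; rewrite -leeBlDr// ltW.
Qed.

(** K and its translates by small y lie in one open U of nearly the same measure. The transforms of
    K and of y + K are therefore both within 2h of that of U, and they differ by the factor g (- y).
    Hence |g y - 1| times the transform of K is at most 4h = e eta, so where that transform is at
    least e in modulus, |g y - 1| <= eta. *)
Lemma vanishes_hat_compact (K : set G) : compact K -> vanishes_at_infinity (hat m K).
Proof.
move=> cK e e0; have mK : measurable (K : set (Borel G)) by exact: compact_borel.
have fK : (m K < +oo)%E by case: haarm => h _ _ _ _; exact: h.
have /(@choice _ _ (fun eta W => 0 < eta -> nbhs (0 : G) W /\ forall g y, character g ->
    W y -> cabs (g y - 1) * cabs (hat m K g) <= e * eta))[W hW] (eta : R) :
    exists W, 0 < eta -> nbhs (0 : G) W /\ forall g y, character g ->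
    W y -> cabs (g y - 1) * cabs (hat m K g) <= e * eta.
  have [eta0|_] := ltP 0 eta; last by exists setT.
  pose h := e * eta / 4; have h0 : 0 < h by rewrite divr_gt0// mulr_gt0.
  have [U [oU KU fU mU]] := haar_outer mK fK h0.
  have [W W0 KW] := compact_thickening cK oU KU.
  exists W => _; split => // g y cg Wy.
  have mKy := measurable_translate y mK; have mOU := open_borel oU.
  have e1 := hat_subset mOU mK KU fU mU cg.
  have e2 : cabs (hat m U g - hat m [set y + x | x in K] g) <= 2 * h.
    apply: hat_subset => //; last by rewrite haar_translate.
    by move=> _ [x Kx <-]; rewrite addrC; exact: KW.
  move: e2; rewrite hat_translate// => e2.
  rewrite -cabs_characterN_sub1// -cabsM mulrBl mul1r.
  apply: le_trans (cabs_dist _ (hat m U g) _) _.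
  by rewrite (cabsBC (_ * _)); move: e1 e2; rewrite /h; lra.
exists (equicontinuous_characters W).
  by apply: dual_compact_equicontinuous_characters => eta eta0; exact: (hW eta eta0).1.
move=> g cg nWg; rewrite ltNge; apply/negP => le_e; apply: nWg; split => // eta eta0 y Wy.
have := (hW eta eta0).2 g y cg Wy.
have h1 : cabs (g y - 1) * e <= cabs (g y - 1) * cabs (hat m K g).
  by rewrite ler_wpM2l// cabs_ge0.
by move=> /(le_trans h1); rewrite mulrC ler_pM2l.
Qed.

(** [haar] gives inner regularity for open sets only. The set is therefore compared with a compact
    set through a common open superset, and the compact set need not lie in [A]. *)
Lemma vanishes_hat A : measurable A -> (m A < +oo)%E -> vanishes_at_infinity (hat m A).
Proof.
move=> mA fA; apply: vanishes_approx => e e0; have e4 : 0 < e / 4 by lra.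
have [U [oU AU fU mU]] := haar_outer mA fA e4.
have [K [cK KU mK]] := haar_inner oU fU e4.
exists (hat m K); first exact: vanishes_hat_compact.
move=> g cg; apply: le_trans (cabs_dist _ (hat m U g) _) _; rewrite cabsBC.
have := hat_subset (open_borel oU) mA AU fU mU cg.
have := hat_subset (open_borel oU) (compact_borel hausG cK) KU fU mK cg.
lra.
Qed.

End Haar.

Import HBSimple.

(** * The Riemann-Lebesgue lemma for integrable functions *)

Section FourierL1.
Context {R : realType} {G : topologicalZmodType}.
Variable m : {measure set (Borel G) -> \bar R}.
Hypotheses (hausG : hausdorff_space G) (haarm : haar m).

Lemma cintegrable_indic_cst (b : R[i]) (E : set (Borel G)) : measurable E -> (m E < +oo)%E ->
  cintegrable m setT (fun x => b * cindic E x).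
Proof.
move=> mE fE; apply: cintegrableZ => //.
apply: (@cintegrable_eq _ _ _ m setT (fun x => cindic E x * 1)).
  by move=> x; rewrite mulr1.
apply: cintegrable_indic => //; apply: cbounded_cintegrable => //.
exact: (@cbounded_cst _ _ (1 : R[i])).
Qed.

Lemma hatL_step (J : finType) (b : J -> R[i]) (E : J -> set (Borel G)) :
  (forall j, measurable (E j)) -> (forall j, (m (E j) < +oo)%E) ->
  L1 m (fun x => \sum_j b j * cindic (E j) x) /\
  forall g, character g ->
    hatL m (fun x => \sum_j b j * cindic (E j) x) g = \sum_j b j * hat m (E j) g.
Proof.
move=> mE fE; split.
  by apply: (cintegrable_sum (mu := m)) => // j; exact: cintegrable_indic_cst.
move=> g cg; have cg' := cbounded_character (character_conj cg).
have ci j : cintegrable m setT (fun x => cindic (E j) x * g (- x)).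
  by apply: cintegrable_indic => //; exact: cbounded_cintegrable.
transitivity (cint_on m setT (fun x => \sum_j b j * (cindic (E j) x * g (- x)))).
  by apply: eq_cint_on => x _; rewrite mulr_suml; under eq_bigr do rewrite -mulrA.
rewrite cint_on_sum//; last by move=> j; exact: cintegrableZ.
by apply: eq_bigr => j _; rewrite cint_onZ// cint_on_indic.
Qed.

Lemma sfun_step (s : {sfun Borel G >-> R}) : m.-integrable setT (fun x : Borel G => (s x)%:E) ->
  exists (J : finType) (b : J -> R[i]) (E : J -> set (Borel G)),
    [/\ forall j, measurable (E j), forall j, (m (E j) < +oo)%E &
        forall x, (s x)%:C%C = \sum_j b j * cindic (E j) x].
Proof.
move=> is_.
(* The level set of 0 may have infinite measure; its coefficient vanishes. *)
pose E (r : R) : set (Borel G) := if r == 0 then set0 else s @^-1` [set r].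
have mE r : measurable (E r) by rewrite /E; case: eqP.
have fE r : (m (E r) < +oo)%E.
  rewrite /E; case: eqVneq => [|r0]; first by rewrite measure0.
  have mr : measurable (s @^-1` [set r]) by [].
  have /integrableP[_] := integrableS measurableT mr (@subsetT _ _) is_.
  rewrite (@eq_integral _ _ _ m _ (fun=> `|r|%:E)); last by move=> x /set_mem /= ->.
  rewrite integral_cst//; case: (m (s @^-1` [set r])) (measure_ge0 m (s @^-1` [set r])) => [t _ _|_|//]; first by rewrite ltry.
  by rewrite mulry gtr0_sg ?normr_gt0// mul1e.
exists (fset_set (range s) : finType), (fun r => (val r)%:C%C), (fun r => E (val r)).
split => // x; rewrite [s x]fimfunE fsbig_finite//= big_seq_fsetE /= rmorph_sum.
apply: eq_bigr => r _; rewrite rmorphM /= /cindic /E.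
by case: eqP => [->|//]; rewrite !mul0r.
Qed.

Lemma integrable_sfun_approx (h : Borel G -> R) (e : R) : m.-integrable setT (EFin \o h) ->
  0 < e -> exists2 s : {sfun Borel G >-> R}, m.-integrable setT (fun x : Borel G => (s x)%:E) &
    Rintegral m setT (fun x => `|h x - s x|) < e.
Proof.
move=> ih e0; have [u [iu _ ul]] := approximation_sfun_integrable measurableT ih.
have : nbhs (0 : \bar R) [set y | (y < e%:E)%E].
  by apply: open_nbhs_nbhs; split; [exact: open_ereal_lt_ereal|rewrite /= lte_fin].
move=> /ul[N _ /(_ N (leqnn N)) /= lt_e]; exists (u N); first exact: iu.
suff : ((Rintegral m setT (fun x => `|h x - u N x|))%:E < e%:E)%E by rewrite lte_fin.
move: lt_e; congr (_ < _)%E; rewrite /Rintegral fineK.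
  by apply: eq_integral.
have idiff := integrable_abse (integrableB measurableT ih (iu N)).
apply: (integrable_fin_num measurableT).
by move: idiff; congr (integrable _ _ _); apply/funext => x /=.
Qed.

Lemma vanishes_hatL (f : G -> R[i]) : L1 m f -> vanishes_at_infinity (hatL m f).
Proof.
move=> Lf; have [f1 f2] := Lf; apply: vanishes_approx => e e0.
have e4 : 0 < e / 4 by lra.
have [s is_ hs] := integrable_sfun_approx f1 e4.
have [t it_ ht] := integrable_sfun_approx f2 e4.
have [J [b [E [mE fE sE]]]] := sfun_step is_.
have [L [c [F [mF fF tF]]]] := sfun_step it_.
pose S x : R[i] := (s x)%:C%C + 'i * (t x)%:C%C.
have SE : S = fun x => \sum_k sum_family b (fun l => 'i * c l) k * cindic (sum_family E F k) x.
  apply/funext => x; rewrite big_sum_type /= /S sE tF mulr_sumr.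
  by congr (_ + _); apply: eq_bigr => l _; rewrite mulrA.
have [||LS hatS] := @hatL_step (J + L)%type (sum_family b (fun l => 'i * c l)) (sum_family E F).
- by case.
- by case.
rewrite -SE in LS hatS.
exists (fun g => \sum_k sum_family b (fun l => 'i * c l) k * hat m (sum_family E F k) g).
  apply: vanishes_sum => -[j|l].
    exact: (vanishes_hat hausG haarm (mE j) (fE j)).
  exact: (vanishes_hat hausG haarm (mF l) (fF l)).
move=> g cg; rewrite -hatS//.
have cg' := cbounded_character (character_conj cg).
have mg1 : measurable_fun [set: Borel G] (fun x : Borel G => complex.Re (g (- x))).
  case: cg' => c1 _ _; exact: (continuous_borel c1).
have mg2 : measurable_fun [set: Borel G] (fun x : Borel G => complex.Im (g (- x))).
  case: cg' => _ c2 _; exact: (continuous_borel c2).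
have g1 x : cabs (g (- x)) <= 1 by rewrite cabs_character.
have if_ : cintegrable m setT (fun x => f x * g (- x)).
  exact: (cintegrable_mul_bounded (mu := m) (u := fun x : Borel G => g (- x)) Lf mg1 mg2 g1).
have iS : cintegrable m setT (fun x => - 1 * (S x * g (- x))).
  apply: cintegrableZ => //.
  exact: (cintegrable_mul_bounded (mu := m) (u := fun x : Borel G => g (- x)) LS mg1 mg2 g1).
have -> : hatL m f g - hatL m S g =
    cint_on m setT (fun x => f x * g (- x) + - 1 * (S x * g (- x))).
  rewrite cint_onD// cint_onZ ?mulN1r//.
  exact: (cintegrable_mul_bounded (mu := m) (u := fun x : Borel G => g (- x)) LS mg1 mg2 g1).
have i1 : m.-integrable setT (EFin \o (fun x => `|complex.Re (f x) - s x|)).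
  have := integrable_abse (integrableB measurableT f1 is_).
  by congr (integrable _ _ _); apply/funext.
have i2 : m.-integrable setT (EFin \o (fun x => `|complex.Im (f x) - t x|)).
  have := integrable_abse (integrableB measurableT f2 it_).
  by congr (integrable _ _ _); apply/funext.
apply: le_trans (_ : _ <= 2 * Rintegral m setT
    (fun x => `|complex.Re (f x) - s x| + `|complex.Im (f x) - t x|)) _; last first.
  by rewrite RintegralD//; lra.
apply: cabs_cint_on_le => //.
- exact: cintegrableD.
- have := integrableD measurableT i1 i2.
  by congr (integrable _ _ _); apply/funext.
move=> x _; rewrite mulN1r -mulrBl cabsM (cabs_character cg) mulr1.
apply: le_trans (ler_cabs_ReIm _) _; rewrite ReD ImD ReN ImN /S.
rewrite ReD ImD ReM ImM -complexiE /=.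
by rewrite !(mul0r, mulr0, mul1r) !(subr0, add0r, addr0).
Qed.

End FourierL1.

(** * Approximation of Rajchman measures by integrable functions *)

Section Measures.
Context {R : realType} {G : topologicalZmodType}.
Hypothesis hausG : hausdorff_space G.
Implicit Types (mu : cmeasure R G) (phi : (G -> R[i]) -> R[i]).

Lemma regular_tight_on (n : {measure set (Borel G) -> \bar R}) :
  (n setT < +oo)%E -> regular_measure n -> tight_on n setT.
Proof.
move=> fn [_ /(_ setT measurableT) inner]; split => // e e0.
have fn' : n setT \is a fin_num by rewrite ge0_fin_numE.
have : (n setT - e%:E < n setT)%E by rewrite lteBlDr// lteDl// lte_fin.
rewrite [X in (_ < X)%E]inner => /ereal_sup_gt[_ [K [cK _] <-] nK].
exists K => //; have mK := compact_borel hausG cK.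
rewrite measureD// setTI leeBlDr; last first.
  by rewrite ge0_fin_numE// (finite_measureS measurableT).
by rewrite addeC -leeBlDr// ltW.
Qed.

(** The left-nested shape phi + b psi is the one to which [tight_functional_add] and
    [discretizable_add] apply. *)
Lemma hatME mu : hatM mu = fun g =>
  ((hat (cm1 mu) setT g + (- 1) * hat (cm2 mu) setT g) + 'i * hat (cm3 mu) setT g) +
  (- 'i) * hat (cm4 mu) setT g.
Proof. by apply/funext => g; rewrite /hatM /cm_int /hat /cint_on /cint; ring. Qed.

Lemma tight_functional_hatM mu : in_M mu -> tight_functional (hatM mu).
Proof.
move=> [[f1 f2 f3 f4] [r1 r2 r3 r4]]; rewrite hatME.
by do 3 ?apply: tight_functional_add; apply: tight_functional_hat => //; exact: regular_tight_on.
Qed.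

Lemma discretizable_hatM mu : in_M mu -> discretizable (hatM mu).
Proof.
move=> [[f1 f2 f3 f4] [r1 r2 r3 r4]]; rewrite hatME.
by do 3 ?apply: discretizable_add; apply: discretizable_hat => //; exact: regular_tight_on.
Qed.

Lemma tight_functional_bounded phi : tight_functional phi -> exists2 C : R, 0 <= C &
  forall (I : finType) (c : I -> R[i]) (g : I -> G -> R[i]), (forall i, character (g i)) ->
  forall B, (forall x, cabs (trig c g x) <= B) -> cabs (pairing c g phi) <= C * B.
Proof.
move=> [M M0 tM]; have [K cK hK] := tM 1 ltr01.
exists (M + 1); first by rewrite addr_ge0.
move=> I c g cg B pB; have B0 : 0 <= B by apply: le_trans (pB 0); exact: cabs_ge0.
by have := hK I c g cg B B B0 pB (fun x _ => pB x); rewrite mulrDl.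
Qed.

Lemma trig_single (g : G -> R[i]) x : trig (fun _ : 'I_1 => 1) (fun=> g) x = g x.
Proof. by rewrite /trig big_ord1 mul1r. Qed.

Lemma pairing_single (g : G -> R[i]) phi : pairing (fun _ : 'I_1 => 1) (fun=> g) phi = phi g.
Proof. by rewrite /pairing big_ord1 mul1r. Qed.

(** The difference of two characters is a polynomial of norm at most 2, and it is small on K when
    the characters are close in the compact-open topology. *)
Lemma tight_functional_continuous phi : tight_functional phi -> dual_continuous phi.
Proof.
move=> [M M0 tM] g cg e e0; have [|K cK hK] := tM (e / 8); first lra.
pose eta := e / (4 * (M + 1)).
have eta0 : 0 < eta by rewrite divr_gt0// mulr_gt0//; lra.
have etaE : eta * (4 * (M + 1)) = e by rewrite divfK// gt_eqF// mulr_gt0//; lra.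
exists [set h | character h /\ exists2 e', e' < eta & forall x, K x -> cabs (h x - g x) <= e'].
split; first exact: dual_open_ball.
  by split=> //; exists 0 => // x _; rewrite subrr cabs0.
move=> h [ch [e' e'eta hKe]].
rewrite -(pairing_single h phi) -(pairing_single g phi) -pairing_sub.
apply: le_lt_trans (hK _ _ _ _ 2 eta (ltW eta0) _ _) _.
- by case.
- move=> x; rewrite trig_sub !trig_single; apply: le_trans (cabsB _ _) _.
  by rewrite !cabs_character//; lra.
- by move=> x /hKe; rewrite trig_sub !trig_single; lra.
- lra.
Qed.

Lemma normVg_le_normV (V : set (G -> R[i])) phi g : character g ->
  (normVg V phi g <= normV V phi)%E.
Proof. by move=> cg; apply: ereal_sup_ubound; exists g. Qed.

(** The single character [g] is a test polynomial for its own translate of V, because V contains the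
    trivial character. *)
Lemma cabs_le_normV (V : set (G -> R[i])) phi g (e : R) :
  dual_open V -> V (@dual_zero R G) -> character g ->
  (normV V phi <= e%:E)%E -> cabs (phi g) <= e.
Proof.
move=> oV V0 cg le_e.
have := @normVg_ge R G V phi g e 1 1 (fun=> 1) (fun=> g) (le_trans (normVg_le_normV V phi cg) le_e).
rewrite pairing_single mulr1; apply => //.
- by move=> i j _; rewrite !ord1.
- move=> _; exists (@dual_zero R G); rewrite dual_add0; split => //; split.
    exact: character_one.
  by move=> U _ U0; exists (@dual_zero R G).
- by move=> x; rewrite trig_single cabs_character.
Qed.

Lemma M0_of_approx (V : set (G -> R[i])) (m : {measure set (Borel G) -> \bar R}) mu :
  dual_open V -> V (@dual_zero R G) -> haar m -> in_M mu ->
  (forall eps : R, 0 < eps -> exists f : G -> R[i],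
     L1 m f /\ (normV V (fun g => (hatM mu g - hatL m f g)%R) < eps%:E)%E) -> M0 mu.
Proof.
move=> oV V0 haarm Mmu approx; split=> //; split.
  exact/tight_functional_continuous/tight_functional_hatM.
suff van : vanishes_at_infinity (hatM mu).
  by move=> e e0; have [K cK hK] := van e e0; exists K.
apply: vanishes_approx => e e0; have [f [Lf lt_e]] := approx e e0.
exists (hatL m f); first exact: vanishes_hatL.
by move=> g cg; apply: (cabs_le_normV (phi := fun g => hatM mu g - hatL m f g) oV V0 cg (ltW lt_e)).
Qed.

End Measures.

(** * Averaging over a small neighbourhood of 0 *)

Section ApproximateIdentity.
Context {R : realType} {G : topologicalZmodType}.
Variable m : {measure set (Borel G) -> \bar R}.
Variable O : set G.
Hypotheses (mO : measurable (O : set (Borel G))) (fO : (m O < +oo)%E) (pO : 0 < fine (m O)).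

(* The Fourier transform of the normalised indicator function of O. *)
Definition avg (g : G -> R[i]) : R[i] := ((fine (m O))^-1)%:C%C * hat m O g.

Lemma trig_avg (I : finType) (c : I -> R[i]) (g : I -> G -> R[i]) x :
  (forall i, character (g i)) -> trig (fun i => c i * avg (g i)) g x =
  ((fine (m O))^-1)%:C%C * cint_on m O (fun y => trig c g (x - y)).
Proof.
move=> cg.
have -> : cint_on m O (fun y => trig c g (x - y)) =
    cint_on m O (fun y => trig (fun i => c i * g i x) g (- y)).
  by apply: eq_cint_on => y _; apply: eq_bigr => i _; rewrite characterD// mulrA.
rewrite -pairing_hat// /pairing mulr_sumr; apply: eq_bigr => i _.
by rewrite /avg; ring.
Qed.

Lemma cabs_avg_const : cabs ((fine (m O))^-1)%:C%C = (fine (m O))^-1 :> R.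
Proof. by rewrite cabs_real ger0_norm// invr_ge0 ltW. Qed.

Lemma cbounded_trig_translate (I : finType) (c : I -> R[i]) (g : I -> G -> R[i]) x :
  (forall i, character (g i)) -> cbounded (fun y => trig c g (x - y)).
Proof.
move=> cg; have -> : (fun y => trig c g (x - y)) =
    (fun y => trig (fun i => c i * g i x) g (- y)).
  by apply/funext => y; apply: eq_bigr => i _; rewrite characterD// mulrA.
exact: cbounded_trig_opp.
Qed.

Lemma trig_avg_bound (I : finType) (c : I -> R[i]) (g : I -> G -> R[i]) (B : R) :
  (forall i, character (g i)) -> (forall x, cabs (trig c g x) <= B) ->
  forall x, cabs (trig (fun i => c i * avg (g i)) g x) <= 2 * B.
Proof.
move=> cg pB x; rewrite trig_avg// cabsM cabs_avg_const mulrC ler_pdivrMr//.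
rewrite -mulrA; apply: cabs_cint_on_bound => //.
by apply: cbounded_cintegrable => //; exact: cbounded_trig_translate.
Qed.

Lemma trig_avg_close (I : finType) (c : I -> R[i]) (g : I -> G -> R[i]) (delta : R) :
  (forall i, character (g i)) ->
  (forall x y, O y -> cabs (trig c g (x - y) - trig c g x) <= delta) ->
  forall x, cabs (trig c g x - trig (fun i => c i * avg (g i)) g x) <= 2 * delta.
Proof.
move=> cg pO' x; rewrite cabsBC.
have -> : trig (fun i => c i * avg (g i)) g x - trig c g x = ((fine (m O))^-1)%:C%C *
    cint_on m O (fun y => trig c g (x - y) + - trig c g x).
  rewrite cint_onD//.
  - rewrite cint_on_cst// mulrDr -trig_avg// mulrA -rmorphM mulVf ?gt_eqF//.
    by rewrite rmorph1 mul1r.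
  - by apply: cbounded_cintegrable => //; exact: cbounded_trig_translate.
  - by apply: cbounded_cintegrable => //; exact: cbounded_cst.
rewrite cabsM cabs_avg_const mulrC ler_pdivrMr// -mulrA; apply: cabs_cint_on_bound => //.
  apply: cintegrableD => //.
  - by apply: cbounded_cintegrable => //; exact: cbounded_trig_translate.
  - by apply: cbounded_cintegrable => //; exact: cbounded_cst.
by move=> y Oy; exact: pO'.
Qed.

End ApproximateIdentity.

Section Approximation.
Context {R : realType} {G : topologicalZmodType}.

Lemma trig_scale (I : finType) (b : R[i]) (c : I -> R[i]) (g : I -> G -> R[i]) x :
  trig (fun i => b * c i) g x = b * trig c g x.
Proof. by rewrite /trig mulr_sumr; apply: eq_bigr => i _; rewrite mulrA. Qed.

Lemma pairing_scale (I : finType) (b : R[i]) (c : I -> R[i]) (g : I -> G -> R[i]) phi :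
  pairing (fun i => b * c i) g phi = b * pairing c g phi.
Proof. by rewrite /pairing mulr_sumr; apply: eq_bigr => i _; rewrite mulrA. Qed.

Lemma trig_convolve (I J : finType) (c : I -> R[i]) (g : I -> G -> R[i]) (a : J -> R[i])
    (x : J -> G) z : (forall i, character (g i)) ->
  trig (fun i => c i * \sum_j a j * g i (- x j)) g z = \sum_j a j * trig c g (z - x j).
Proof.
move=> cg; rewrite /trig.
under [RHS]eq_bigr do rewrite mulr_sumr; rewrite exchange_big /=.
apply: eq_bigr => i _; rewrite mulr_sumr mulr_suml; apply: eq_bigr => j _.
by rewrite characterD//; ring.
Qed.

(* The approximant is f = nu * k with k = 1_O / m(O). The order of the choices matters:
   Om controls mu outside a compact set, O is so small that k is almost an identity on
   Om, Om2 controls k, and nu discretises mu finely enough for the frequencies in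
   Om and Om2. Since nu is finitely supported, no Fubini theorem is needed. *)
Lemma approx_of_M0 (V : set (G -> R[i])) (m : {measure set (Borel G) -> \bar R})
    (mu : cmeasure R G) (eps : R) :
  hausdorff_space G -> locally_compact [set: G] -> dual_compact (dual_closure V) ->
  haar m -> M0 mu -> 0 < eps ->
  exists f : G -> R[i],
    L1 m f /\ (normV V (fun g => (hatM mu g - hatL m f g)%R) < eps%:E)%E.
Proof.
move=> hausG lcG cV haarm [Mmu [_ vmu]] eps0; set phi := hatM mu.
have tphi : tight_functional phi by exact: tight_functional_hatM.
have vphi : vanishes_at_infinity phi.
  by move=> e e0; have [K [cK hK]] := vmu e e0; exists K.
have [D D0 hD] := discretizable_hatM hausG Mmu.
have [C C0 hC] := tight_functional_bounded tphi.
(* The constant dominates both totals below: (D + 2) delta when g lies outside [Om] and [Om2], and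
   (3 + 2 C + 2 D) delta otherwise. *)
pose delta := eps / (2 * (3 * D + 2 * C + 5)).
have den0 : 0 < 2 * (3 * D + 2 * C + 5) by lra.
have delta0 : 0 < delta by rewrite divr_gt0.
have deltaE : (3 * D + 2 * C + 5) * delta = eps / 2.
  have : delta * (2 * (3 * D + 2 * C + 5)) = eps by rewrite divfK// gt_eqF.
  by lra.
have [Om cOm hOm] := normVg_vanishes lcG cV tphi vphi delta0.
have eqV := dual_compact_equicontinuous0 lcG cV.
have [e1 e10 bern] := @trig_equicontinuous R G delta delta0.
(* The relevant spectra lie in V + g with g in [Om]; the union of these translates is still
   equicontinuous. *)
have [U U0 hU] := equicontinuous0_shift cV.1 eqV (dual_compact_equicontinuous0 lcG cOm) e10.
have [K0 cK0 nK0] := nbhs0_compact lcG.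
(* Convolution evaluates at x - y, hence the reflected condition; [K0] makes the measure of [O]
   finite. *)
pose O : set G := interior (K0 `&` [set y | U (- y)]).
have nO : nbhs (0 : G) O by apply/nbhs_interior/filterI => //; exact: nbhs0_opp.
have oO : open O by exact: open_interior.
have mO : measurable (O : set (Borel G)) by exact: open_borel.
have OK0 : O `<=` K0 by move=> y /interior_subset[].
have OU y : O y -> U (- y) by move=> /interior_subset[].
have mK0 := compact_borel hausG cK0.
have fK0 : (m K0 < +oo)%E by case: haarm => h _ _ _ _; exact: h.
have fO : (m O < +oo)%E := finite_measureS mK0 mO OK0 fK0.
have pO : 0 < fine (m O).
  rewrite fine_gt0// fO andbT; case: haarm => _ _ _ _; apply => //.
  by exists 0; exact: nbhs_singleton.
have tO : tight_on m O.
  split=> // e e0; exists K0 => //; have -> : O `\` K0 = set0 by rewrite setD_eq0.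
  by rewrite measure0 lee_fin ltW.
(* The tolerance carries the factor m(O), which cancels against the normalisation in [avg]. *)
have dO : 0 < delta * fine (m O) by rewrite mulr_gt0.
have [Om2 cOm2 hOm2] := normVg_vanishes lcG cV (tight_functional_hat hausG tO)
  (vanishes_hat hausG haarm mO fO) dO.
have [U' U'0 hU'] := equicontinuous0_shift cV.1 eqV
  (dual_compact_equicontinuous0 lcG (dual_compactU cOm cOm2)) e10.
have [J [a [x [sa ha]]]] := hD delta U' delta0 U'0.
pose kap : R[i] := ((fine (m O))^-1)%:C%C.
pose E j : set (Borel G) := [set x j + y | y in O].
have [||Lf hf] := @hatL_step R G m J (fun j => a j * kap) E.
- by move=> j; exact: measurable_translate.
- by move=> j; rewrite /E haar_translate.
pose f (y : G) : R[i] := \sum_j a j * kap * cindic (E j) y.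
exists f; split; first exact: Lf.
pose nu (g : G -> R[i]) := \sum_j a j * g (- x j).
have hfE g : character g -> hatL m f g = nu g * avg m O g.
  move=> cg; rewrite hf// /nu mulr_suml; apply: eq_bigr => j _.
  by rewrite hat_translate// /avg -/kap; ring.
apply: (@le_lt_trans _ _ (eps / 2)%:E); last by rewrite lte_fin; lra.
apply: ub_ereal_sup => _ [g cg <-]; apply: normVg_le => n c h ih hS h1.
have ch i : character (h i) by exact: (dual_shift_character cV.1 cg (hS i)).
have -> : pairing c h (fun g => phi g - hatL m f g) =
    pairing c h phi - pairing c h (fun g => nu g * avg m O g).
  by rewrite /pairing -sumrB; apply: eq_bigr => i _; rewrite hfE// mulrBr.
have hD' : 0 <= D * delta by rewrite mulr_ge0// ltW.
have hC' : 0 <= C * delta by rewrite mulr_ge0// ltW.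
(* Outside both sets the two terms are small separately, and nu contributes only its total mass, at
   most D. The bound D + 1 is used because [normVg_ge] asks for a positive one. *)
have [Og|nOg] := pselect ((Om `|` Om2) g); last first.
  have b1 : cabs (pairing c h phi) <= delta * 1.
    by apply: normVg_ge ih hS ltr01 h1; apply: hOm => // Og; apply: nOg; left.
  have b2 : cabs (pairing (fun i => c i * nu (h i)) h (hat m O)) <=
      delta * fine (m O) * (D + 1).
    apply: normVg_ge ih hS _ _; first by apply: hOm2 => // Og; apply: nOg; right.
      lra.
    move=> z; rewrite trig_convolve//; apply: le_trans (cabs_sum _) _.
    apply: (@le_trans _ _ D); last lra.
    apply: le_trans sa; apply: ler_sum => j _; rewrite cabsM.
    by rewrite ler_piMr ?cabs_ge0.
  have -> : pairing c h (fun g => nu g * avg m O g) =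
      kap * pairing (fun i => c i * nu (h i)) h (hat m O).
    by rewrite /pairing mulr_sumr; apply: eq_bigr => i _; rewrite /avg -/kap; ring.
  apply: le_trans (cabsB _ _) _; rewrite [cabs (kap * _)]cabsM cabs_avg_const//.
  have b3 : (fine (m O))^-1 * cabs (pairing (fun i => c i * nu (h i)) h (hat m O)) <=
      delta * (D + 1).
    by rewrite mulrC ler_pdivrMr// mulrAC.
  by lra.
(* These are the coefficients of k * p. The error splits into mu paired with p - k * p ([key1]) and
   mu - nu paired with k * p ([key2]). *)
pose d i := c i * avg m O (h i).
have d2 : forall z, cabs (trig d h z) <= 2.
  by move=> z; have := trig_avg_bound mO fO pO ch h1 z; rewrite mulr1.
have key1 : cabs (pairing c h phi - pairing d h phi) <= (3 + 2 * C) * delta.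
  have -> : pairing c h phi - pairing d h phi = pairing (fun i => c i - d i) h phi.
    by rewrite /pairing -sumrB; apply: eq_bigr => i _; rewrite mulrBl.
  have trigB z : trig (fun i => c i - d i) h z = trig c h z - trig d h z.
    by rewrite /trig -sumrB; apply: eq_bigr => i _; rewrite mulrBl.
  (* For g in [Om], k * p is uniformly close to p. For g in [Om2] only, the local norm of the
     transform of mu is small, and the crude bound 1 + 2 = 3 on p - k * p is enough. *)
  have [Og1|nOg1] := pselect (Om g).
    apply: (@le_trans _ _ (C * (2 * delta))); last by lra.
    apply: hC => // z; rewrite trigB; apply: trig_avg_close => // z' y Oy.
    apply: bern => // i; apply: hU; last exact: OU.
    by exists g.
  apply: (@le_trans _ _ (delta * 3)); last by lra.
  apply: normVg_ge ih hS _ _ => //; first exact: hOm.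
  move=> z; rewrite trigB; apply: le_trans (cabsB _ _) _.
  by have := h1 z; have := d2 z; lra.
have key2 : cabs (pairing d h phi - pairing c h (fun g => nu g * avg m O g)) <= 2 * D * delta.
  have -> : pairing c h (fun g => nu g * avg m O g) = \sum_j a j * trig d h (- x j).
    transitivity (trig (fun i => d i * \sum_j a j * h i (- x j)) h 0).
      by apply: eq_bigr => i _; rewrite character0// /d /nu; ring.
    by rewrite trig_convolve//; under eq_bigr do rewrite sub0r.
  (* The discretisation is stated for norm at most 1, whereas the available bound on k * p is 2. *)
  pose half : R[i] := (2^-1)%:C%C.
  have chalf : cabs half = 2^-1 by rewrite cabs_real ger0_norm// invr_ge0.
  have half2 z : cabs (trig (fun i => half * d i) h z) <= 1.
    by rewrite trig_scale cabsM chalf; have := d2 z; lra.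
  have := ha 'I_n (fun i => half * d i) h ch half2.
  rewrite pairing_scale; under eq_bigr do rewrite trig_scale mulrCA.
  rewrite -mulr_sumr -mulrBr cabsM chalf => hh.
  suff : 2^-1 * cabs (pairing d h phi - \sum_j a j * trig d h (- x j)) <= D * delta by lra.
  apply: hh => z y U'y; apply: bern => // i; apply: hU' => //.
  by exists g.
apply: le_trans (cabs_dist _ (pairing d h phi) _) _.
by lra.
Qed.

End Approximation.

Theorem theorem3p4 (R : realType) (G : topologicalZmodType)
  (hausG : hausdorff_space G) (lcG : locally_compact [set: G])
  (ndG : nondiscrete G)
  (V : set (G -> R[i])) (Vopen : dual_open V) (V0 : V (@dual_zero R G))
  (Vcpt : dual_compact (dual_closure V)) :
  (forall mu : cmeasure R G, M0 mu -> cm_nonzero mu ->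
     forall eps : R, 0 < eps ->
       exists Om : set (G -> R[i]),
         [/\ dual_compact Om,
             dual_interior Om !=set0,
             Om `<=` dual_closure (dual_interior Om) &
             (ereal_sup [set normVg V (hatM mu) g | g in @dual R G `\` Om]
                <= eps%:E)%E])
  /\
  (forall m : {measure set (Borel G) -> \bar R}, haar m ->
     forall mu : cmeasure R G, in_M mu ->
       (M0 mu <->
        forall eps : R, 0 < eps ->
          exists f : G -> R[i],
            L1 m f /\
            (normV V (fun g => (hatM mu g - hatL m f g)%R) < eps%:E)%E)).
Proof.
split=> [mu [Mmu [_ vmu]] _ eps eps0|m haarm mu Mmu].
  have vphi : vanishes_at_infinity (hatM mu).
    by move=> e e0; have [K [cK hK]] := vmu e e0; exists K.
  have [K cK hK] := normVg_vanishes lcG Vcpt (tight_functional_hatM hausG Mmu) vphi eps0.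
  have [Om [cOm iOm rOm KOm]] := regular_compact_cover Vopen V0 Vcpt cK.
  exists Om; split => //; apply: ub_ereal_sup => _ [g [cg nOm] <-].
  by apply: hK => // Kg; apply: nOm; exact: KOm.
split; first by move=> M0mu eps eps0; exact: approx_of_M0.
exact: M0_of_approx.
Qed.
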